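(* Let $(D\subset A)$ be a separable Cartan pair, i.e. $A$ is a separable $\mathrm C^*$-algebra and $D\subset A$ is a Cartan subalgebra. Then $v\in A$ is a normaliser of $D$ if and only if $v$ and $v^*$ satisfy the NEP.
   Context: An abelian $\mathrm C^*$-subalgebra $D$ of a $\mathrm C^*$-algebra $A$ is a Cartan subalgebra if (0) $D$ contains an approximate unit of $A$; (1) $D$ is maximal abelian; (2) the set of normalisers $N_A(D)=\{x\in A: x^*Dx\subset D,\ xDx^*\subset D\}$ generates $A$ as a $\mathrm C^*$-algebra; (3) there is a faithful conditional expectation $A\to D$. For a state $\rho$ on a separable $\mathrm C^*$-algebra $B$, a sequence $(k_n)_n$ of norm one elements in $B_+$ excises $\rho$ if $\|k_nbk_n-\rho(b)k_n^2\|\to 0$ for every $b\in B$. $\hat D$ is the spectrum of $D$, and for $x\in\hat D$, $\rho_x$ is the pure state on $D$ given by evaluation at $x$. Normaliser excision property (NEP): $v\in A$ satisfies the NEP if for each $x\in\hat D$ there is at most one $y\in\hat D$ such that there exist sequences $(k_n)_n$ in $D$ excising $\rho_x$ and $(l_n)_n$ in $D$ excising $\rho_y$ (both as states on $D$) for which the sequence $(\|l_nvk_n\|)_n$ does not converge to $0$. *)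

(* Defs.v *)
From HB Require Import structures.
From mathcomp Require Import all_boot all_order all_algebra complex.
From mathcomp Require Import all_classical all_reals.
From mathcomp Require Import topology normedtype sequences.

Set Implicit Arguments.
Unset Strict Implicit.
Unset Printing Implicit Defensive.

Import Order.TTheory GRing.Theory Num.Theory numFieldNormedType.Exports.
Local Open Scope classical_set_scope.
Local Open Scope ring_scope.

Reserved Notation "x ** y" (at level 40, left associativity).

(* C*-algebras are not assumed unital, which is why the product is part of
   the mixin instead of coming from the (unital) ring hierarchy. *)
HB.mixin Record CompleteNormedModule_isCStarAlgebra (R : realType) A
    of CompleteNormedModule R[i] A := {
  cmul : A -> A -> A;
  star : A -> A;
  cmulA : forall x y z : A, cmul x (cmul y z) = cmul (cmul x y) z;
  cmulDl : forall x y z : A, cmul (x + y) z = cmul x z + cmul y z;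
  cmulDr : forall x y z : A, cmul x (y + z) = cmul x y + cmul x z;
  cscaleAl : forall (a : R[i]) (x y : A), cmul (a *: x) y = a *: cmul x y;
  cscaleAr : forall (a : R[i]) (x y : A), cmul x (a *: y) = a *: cmul x y;
  starK : forall x : A, star (star x) = x;
  starD : forall x y : A, star (x + y) = star x + star y;
  starZ : forall (a : R[i]) (x : A), star (a *: x) = (a^*)%R *: star x;
  starM : forall x y : A, star (cmul x y) = cmul (star y) (star x);
  cnormM : forall x y : A, `|cmul x y| <= `|x| * `|y|;
  cstar_identity : forall x : A, `|cmul (star x) x| = `|x| ^+ 2
}.

#[short(type="cstarAlgType")]
HB.structure Definition CStarAlgebra (R : realType) :=
  {A of CompleteNormedModule R[i] A
      & CompleteNormedModule_isCStarAlgebra R A}.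

Notation "x ** y" := (cmul x y) : ring_scope.

Definition separable (T : topologicalType) : Prop :=
  exists2 S : set T, countable S & dense S.

(* `|x| lives in the scalar field R[i], where it is a nonnegative element and
   hence has no imaginary part; [cnorm] is the same norm with values in R. *)
Definition cnorm (R : realType) (A : cstarAlgType R) (x : A) : R :=
  complex.Re `|x|.

Section Subalgebras.
Variables (R : realType) (A : cstarAlgType R).
Implicit Types (B D E : set A) (a b d v x : A).

Record cstar_subalgebra B : Prop := CStarSubalgebra {
  csub0 : B 0;
  csubD : forall a b, B a -> B b -> B (a + b);
  csubZ : forall (c : R[i]) a, B a -> B (c *: a);
  csubM : forall a b, B a -> B b -> B (a ** b);
  csubJ : forall a, B a -> B (star a);
  csub_closed : closed B
}.

(* The positive cone of the C*-algebra B. *)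
Definition positive B : set A :=
  [set a | exists2 b, B b & a = star b ** b].

Definition abelian D : Prop := forall a b, D a -> D b -> a ** b = b ** a.

Definition maximal_abelian D : Prop :=
  abelian D /\
  forall E, cstar_subalgebra E -> abelian E -> D `<=` E -> E `<=` D.

(* An approximate unit is a net of positive contractions, indexed by a
   directed preorder; it is not required to be increasing. *)
Definition contains_approximate_unit D : Prop :=
  exists (I : Type) (le : I -> I -> Prop) (u : I -> A),
    [/\ inhabited I,
        (forall i, le i i) /\ (forall i j k, le i j -> le j k -> le i k),
        forall i j, exists k, le i k /\ le j k,
        forall i, [/\ D (u i), positive setT (u i) & `|u i| <= 1] &
        forall (a : A) (e : R), 0 < e -> exists i0, forall i, le i0 i ->
          cnorm (u i ** a - a) < e /\ cnorm (a ** u i - a) < e].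

Definition normaliser D : set A :=
  [set x | (forall d, D d -> D (star x ** d ** x)) /\
           (forall d, D d -> D (x ** d ** star x))].

Definition generates (S : set A) : Prop :=
  forall B, cstar_subalgebra B -> S `<=` B -> B = setT.

(* Complete positivity is a consequence: for b_i in D, the bimodule property
   gives sum_ij b_i^* P(a_i^* a_j) b_j = P(c^* c) with c = sum_j a_j b_j. *)
Record conditional_expectation D (P : {linear A -> A}) : Prop :=
  ConditionalExpectation {
  cexp_range : forall a, D (P a);
  cexp_id : forall d, D d -> P d = d;
  cexp_contractive : forall a, `|P a| <= `|a|;
  cexp_positive : forall a, positive setT a -> positive D (P a);
  cexp_modl : forall d a, D d -> P (d ** a) = d ** P a;
  cexp_modr : forall d a, D d -> P (a ** d) = P a ** d
}.

Definition faithful (P : A -> A) : Prop :=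
  forall a, positive setT a -> P a = 0 -> a = 0.

Record cartan_subalgebra D : Prop := CartanSubalgebra {
  cartan_subalg : cstar_subalgebra D;
  cartan_approx_unit : contains_approximate_unit D;
  cartan_max_abelian : maximal_abelian D;
  cartan_regular : generates (normaliser D);
  cartan_cexp : exists2 P : {linear A -> A},
    conditional_expectation D P & faithful P
}.

(* The points of the spectrum of D are the characters of D, and the pure state
   given by evaluation at the point x is the character x itself. Characters are
   represented by functions on A of which only the values on D are meaningful,
   so equality of points is equality on D. *)
Record spectrum D (x : A -> R[i]) : Prop := Spectrum {
  specD : forall a b, D a -> D b -> x (a + b) = x a + x b;
  specZ : forall (c : R[i]) a, D a -> x (c *: a) = c * x a;
  specM : forall a b, D a -> D b -> x (a ** b) = x a * x b;
  spec_neq0 : exists2 a, D a & x a != 0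
}.

Definition spectrum_eq D (x y : A -> R[i]) : Prop :=
  forall d, D d -> x d = y d.

Definition excises B (rho : A -> R[i]) (k : nat -> A) : Prop :=
  (forall n, positive B (k n) /\ `|k n| = 1) /\
  (forall b, B b ->
    cnorm (k n ** b ** k n - rho b *: (k n ** k n)) @[n --> \oo] --> (0 : R)).

Definition linked D v (x y : A -> R[i]) : Prop :=
  exists k l : nat -> A,
    [/\ excises D x k, excises D y l &
        ~ (cnorm (l n ** v ** k n) @[n --> \oo] --> (0 : R))].

Definition NEP D v : Prop :=
  forall x y y' : A -> R[i],
    spectrum D x -> spectrum D y -> spectrum D y' ->
    linked D v x y -> linked D v x y' -> spectrum_eq D y y'.

End Subalgebras.

(* Main.v *)
(* Let [P] be the conditional expectation, [x] a character of [D] and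
   [phi = x o P]. If [m] is a normaliser with [x(m* m) != 0], then
   [a |-> x(m* a m) / x(m* m)] is a character, the image of [x] under [m]. A
   normaliser only links [x] to its image under it, because
   [v (v* d v) = d v (v* v)]; this gives the NEP.

   Conversely assume the NEP for [v*] and that [v* d v] is not in [D], hence
   does not commute with some [f] in [D]. As [P] is faithful and the normalisers
   span a dense subspace, some [x] and some normaliser [n] satisfy
   [phi(n v* d v) != 0] while [f] separates [x] from its image [x'] under [n*].
   In the GNS space of [phi] normalisers are pairwise orthogonal or proportional,
   so expanding [v] along them gives a normaliser [m] with [phi(n v* d m) != 0]
   and [phi(m* v) != 0]. Hence [v*] links the image of [x] under [m] both to [x']
   and to [x], which contradicts the NEP.

   Characters and excising sequences in a commutative separable [D] come from a
   minimal C*-seminorm [q] among the pointwise limits of seminorms [|T x|], [T] a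
   multiplier: minimality forces [q(h x) = q(h) q(x)] for self-adjoint [h], which
   makes every element of [D] scalar modulo [q]. *)

Require Import Defs.
From mathcomp Require Import all_boot all_order all_algebra complex.
From mathcomp Require Import all_classical all_reals.
From mathcomp Require Import topology normedtype sequences.
From mathcomp Require Import ring lra.

Set Implicit Arguments.
Unset Strict Implicit.
Unset Printing Implicit Defensive.

Import Order.TTheory GRing.Theory Num.Theory numFieldNormedType.Exports.
Local Open Scope classical_set_scope.
Local Open Scope ring_scope.

(** * Real-valued norms, and the calculus of sequences modulo null sequences *)

Section Norm.
Variables (R : realType) (A : cstarAlgType R).
Implicit Types (x y z : A) (c : R[i]) (u w t a b : nat -> A).

Definition cabs c : R := complex.Re `|c|.

Lemma cabsE c : `|c| = (cabs c)%:C%C.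
Proof. by rewrite /cabs RRe_real ?normr_real. Qed.

Lemma cabs_ge0 c : 0 <= cabs c.
Proof. by rewrite -ler0c -cabsE. Qed.

Lemma cabs_eq0 c : (cabs c == 0) = (c == 0).
Proof. by rewrite -[RHS]normr_eq0 cabsE eq_complex /= eqxx andbT. Qed.

Lemma cabs_gt0 c : (0 < cabs c) = (c != 0).
Proof. by rewrite lt_def cabs_ge0 andbT cabs_eq0. Qed.

Lemma cabsM c1 c2 : cabs (c1 * c2) = cabs c1 * cabs c2.
Proof. by apply/complexI; rewrite -cabsE normrM !cabsE rmorphM. Qed.

Lemma cabs_real (r : R) : cabs r%:C%C = `|r|.
Proof. by rewrite /cabs normc_def /= expr0n addr0 sqrtr_sqr. Qed.

Lemma cnormE x : `|x| = (cnorm x)%:C%C.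
Proof. by rewrite /cnorm RRe_real ?normr_real. Qed.

Lemma cnorm_ge0 x : 0 <= cnorm x.
Proof. by rewrite -ler0c -cnormE. Qed.

Lemma cnorm_eq0 x : (cnorm x == 0) = (x == 0).
Proof. by rewrite -[RHS]normr_eq0 cnormE eq_complex /= eqxx andbT. Qed.

Lemma cnorm0 : cnorm (0 : A) = 0.
Proof. by apply/eqP; rewrite cnorm_eq0. Qed.

Lemma cnorm_gt0 x : (0 < cnorm x) = (x != 0).
Proof. by rewrite lt_def cnorm_ge0 andbT cnorm_eq0. Qed.

Lemma cnormN x : cnorm (- x) = cnorm x.
Proof. by rewrite /cnorm normrN. Qed.

Lemma cnormC x y : cnorm (x - y) = cnorm (y - x).
Proof. by rewrite -cnormN opprB. Qed.

Lemma cnormD x y : cnorm (x + y) <= cnorm x + cnorm y.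
Proof. by rewrite -lecR rmorphD /= -!cnormE ler_normD. Qed.

Lemma cnormB x y : cnorm (x - y) <= cnorm x + cnorm y.
Proof. by rewrite -(cnormN y) cnormD. Qed.

Lemma cnormZ c x : cnorm (c *: x) = cabs c * cnorm x.
Proof. by apply/complexI; rewrite rmorphM /= -!cnormE normrZ cabsE. Qed.

Lemma cnorm_mul x y : cnorm (x ** y) <= cnorm x * cnorm y.
Proof. by rewrite -lecR rmorphM /= -!cnormE cnormM. Qed.

Lemma cnorm_starM x : cnorm (star x ** x) = cnorm x ^+ 2.
Proof. by apply/complexI; rewrite rmorphXn /= -!cnormE cstar_identity. Qed.

Lemma cnorm_star x : cnorm (star x) = cnorm x.
Proof.
have le y : cnorm y <= cnorm (star y).
  have := cnorm_mul (star y) y; rewrite cnorm_starM expr2.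
  have [->|] := eqVneq y 0; first by rewrite cnorm0 cnorm_ge0.
  by rewrite -cnorm_gt0 => y0; rewrite ler_pM2r.
by apply/eqP; rewrite eq_le le -{2}(starK x) le.
Qed.

Lemma norm1_cnorm x : `|x| = 1 <-> cnorm x = 1.
Proof. by rewrite cnormE; split=> [[]|->]. Qed.

Lemma cmul0l x : 0 ** x = 0.
Proof. by rewrite -[X in X ** _](scale0r (0 : A)) cscaleAl scale0r. Qed.

Lemma cmul0r x : x ** 0 = 0.
Proof. by rewrite -[X in _ ** X](scale0r (0 : A)) cscaleAr scale0r. Qed.

Lemma cmulNl x y : (- x) ** y = - (x ** y).
Proof. by rewrite -scaleN1r cscaleAl scaleN1r. Qed.

Lemma cmulNr x y : x ** (- y) = - (x ** y).
Proof. by rewrite -scaleN1r cscaleAr scaleN1r. Qed.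

Lemma cmulBl x y z : (x - y) ** z = x ** z - y ** z.
Proof. by rewrite cmulDl cmulNl. Qed.

Lemma cmulBr x y z : x ** (y - z) = x ** y - x ** z.
Proof. by rewrite cmulDr cmulNr. Qed.

Lemma star0 : star (0 : A) = 0.
Proof. by rewrite -[X in star X](scale0r (0 : A)) starZ rmorph0 scale0r. Qed.

Lemma starN x : star (- x) = - star x.
Proof. by rewrite -scaleN1r starZ rmorphN rmorph1 scaleN1r. Qed.

Lemma starB x y : star (x - y) = star x - star y.
Proof. by rewrite starD starN. Qed.

Lemma star_mul_eq0 x : star x ** x = 0 -> x = 0.
Proof.
move=> x0; apply/eqP; rewrite -cnorm_eq0 -sqrf_eq0.
by rewrite -cnorm_starM x0 cnorm0.
Qed.

(** Computing modulo null sequences imitates the quotient of bounded sequences by null ones, where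
    approximate eigenvectors become genuine. Since [aeq] is defined for all sequences, boundedness
    of factors is a separate hypothesis. *)
Definition null u : Prop := cnorm (u n) @[n --> \oo] --> (0 : R).
Definition aeq u w : Prop := null (fun n => u n - w n).
Definition bounded_seq u : Prop := exists C : R, forall n, cnorm (u n) <= C.

Lemma nullP u : null u <->
  forall e : R, 0 < e -> exists N, forall n, (N <= n)%N -> cnorm (u n) < e.
Proof.
split=> [/cvgr0Pnorm_lt h e e0|h].
  have [N _ hN] := h e e0; exists N => n Nn.
  by have := hN n Nn; rewrite /= ger0_norm ?cnorm_ge0.
apply/cvgr0Pnorm_lt => e e0; have [N hN] := h e e0.
by exists N => // n /= Nn; rewrite ger0_norm ?cnorm_ge0 ?hN.
Qed.

Lemma null_le (C : R) u w :
  (forall n, cnorm (u n) <= C * cnorm (w n)) -> null w -> null u.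
Proof.
move=> uw w0; apply: (@squeeze_cvgr _ _ _ _ (fun=> 0) (fun n => C * cnorm (w n))).
- by near=> n; rewrite cnorm_ge0 uw.
- exact: cvg_cst.
- by rewrite -(mulr0 C); apply: cvgM w0; apply: cvg_cst.
Unshelve. all: by end_near. Qed.

Lemma null_ext u w : u =1 w -> null u -> null w.
Proof. by move=> uw; rewrite (funext uw). Qed.

Lemma nullD u w : null u -> null w -> null (fun n => u n + w n).
Proof.
move=> u0 w0; apply: (@squeeze_cvgr _ _ _ _ (fun=> 0) (fun n => cnorm (u n) + cnorm (w n))).
- by near=> n; rewrite cnorm_ge0 cnormD.
- exact: cvg_cst.
- by rewrite -(addr0 0); apply: cvgD.
Unshelve. all: by end_near. Qed.

Lemma null0 : null (fun=> 0).
Proof. by rewrite /null cnorm0; apply: cvg_cst. Qed.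

Lemma nullN u : null u -> null (fun n => - u n).
Proof. by apply: (@null_le 1) => n; rewrite mul1r cnormN. Qed.

Lemma nullZ c u : null u -> null (fun n => c *: u n).
Proof. by apply: (@null_le (cabs c)) => n; rewrite cnormZ. Qed.

Lemma nullMl a u : bounded_seq a -> null u -> null (fun n => a n ** u n).
Proof.
move=> [C aC]; apply: (@null_le C) => n.
by rewrite (le_trans (cnorm_mul _ _))// ler_wpM2r ?cnorm_ge0.
Qed.

Lemma nullMr a u : bounded_seq a -> null u -> null (fun n => u n ** a n).
Proof.
move=> [C aC]; apply: (@null_le C) => n.
by rewrite (le_trans (cnorm_mul _ _))// mulrC ler_wpM2r ?cnorm_ge0.
Qed.

Lemma null_const_norm1 c u :
  (forall n, cnorm (u n) = 1) -> null (fun n => c *: u n) -> c = 0.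
Proof.
move=> u1 cu; apply/eqP; rewrite -cabs_eq0; apply/eqP.
have : (fun n => cnorm (c *: u n)) = (fun=> cabs c).
  by apply/funext => n; rewrite cnormZ u1 mulr1.
move: cu; rewrite /null => /[swap] ->.
by move/(@cvg_lim _ (@norm_hausdorff _ R)); rewrite lim_cst.
Qed.

Lemma bounded_cst x : bounded_seq (fun=> x).
Proof. by exists (cnorm x). Qed.

Lemma bounded_seqM a b :
  bounded_seq a -> bounded_seq b -> bounded_seq (fun n => a n ** b n).
Proof.
move=> [C aC] [C' bC]; exists (C * C') => n.
by rewrite (le_trans (cnorm_mul _ _))// ler_pM ?cnorm_ge0.
Qed.

Lemma bounded_star a : bounded_seq a -> bounded_seq (fun n => star (a n)).
Proof. by move=> [C aC]; exists C => n; rewrite cnorm_star. Qed.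

Lemma bounded_norm1 a : (forall n, cnorm (a n) = 1) -> bounded_seq a.
Proof. by move=> a1; exists 1 => n; rewrite a1. Qed.

Lemma aeq_refl u : aeq u u.
Proof. by apply: null_ext null0 => n; rewrite subrr. Qed.

Lemma aeq_eq u w : u =1 w -> aeq u w.
Proof. by move=> /funext ->; exact: aeq_refl. Qed.

Lemma aeq_sym u w : aeq u w -> aeq w u.
Proof. by move/nullN; apply: null_ext => n; rewrite opprB. Qed.

Lemma aeq_trans w u t : aeq u w -> aeq w t -> aeq u t.
Proof.
by move=> uw wt; apply: null_ext (nullD uw wt) => n; rewrite addrA subrK.
Qed.

Lemma aeqMl a u w : bounded_seq a -> aeq u w ->
  aeq (fun n => a n ** u n) (fun n => a n ** w n).
Proof. by move=> aB /(nullMl aB); apply: null_ext => n; rewrite cmulBr. Qed.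

Lemma aeqMr a u w : bounded_seq a -> aeq u w ->
  aeq (fun n => u n ** a n) (fun n => w n ** a n).
Proof. by move=> aB /(nullMr aB); apply: null_ext => n; rewrite cmulBl. Qed.

Lemma aeqZ c u w : aeq u w -> aeq (fun n => c *: u n) (fun n => c *: w n).
Proof. by move/(nullZ c); apply: null_ext => n; rewrite scalerBr. Qed.

Lemma aeqD u u' w w' : aeq u u' -> aeq w w' ->
  aeq (fun n => u n + w n) (fun n => u' n + w' n).
Proof.
by move=> uu ww; apply: null_ext (nullD uu ww) => n /=; rewrite addrACA opprD.
Qed.

Lemma aeq_null u w : aeq u w -> null w -> null u.
Proof. by move=> uw w0; apply: null_ext (nullD uw w0) => n; rewrite subrK. Qed.

(** Uniqueness of eigenvalues on a norm-one sequence; identities between values of characters are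
    reduced to it. *)
Lemma aeq_norm1_scalar c1 c2 u :
  (forall n, cnorm (u n) = 1) ->
  aeq (fun n => c1 *: u n) (fun n => c2 *: u n) -> c1 = c2.
Proof.
move=> u1 h; apply/eqP; rewrite -subr_eq0; apply/eqP; apply: null_const_norm1 u1 _.
by apply: null_ext h => n; rewrite scalerBl.
Qed.

End Norm.

(** * C*-seminorms on a commutative algebra and their directed infima *)

Section Seminorms.
Variables (R : realType) (A : cstarAlgType R) (D : set A).
Hypotheses (subD : cstar_subalgebra D) (commD : abelian D).
Implicit Types (x y z h s : A) (q : A -> R) (Q : set (A -> R)).

Let DD := csubD subD.
Let DZ := csubZ subD.
Let DM := csubM subD.
Let DJ := csubJ subD.

Lemma csubN x : D x -> D (- x).
Proof. by move=> Dx; rewrite -scaleN1r; apply: DZ. Qed.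

Lemma csubB x y : D x -> D y -> D (x - y).
Proof. by move=> Dx Dy; apply: DD => //; apply: csubN. Qed.

Lemma csub_iter n h x : D h -> D x -> D (iter n (cmul h) x).
Proof. by move=> Dh Dx; elim: n => //= n IH; apply: DM. Qed.

Record multiplier (T : A -> A) : Prop := Multiplier {
  multD : forall x, D x -> D (T x);
  mult_add : forall x y, D x -> D y -> T (x + y) = T x + T y;
  mult_scale : forall (c : R[i]) x, D x -> T (c *: x) = c *: T x;
  mult_mul : forall x y, D x -> D y -> T (x ** y) = x ** T y }.

(* The last clause says that [q] is a pointwise limit of the seminorms
   [x |-> |T x|]; it turns [q]-null vectors into approximate null vectors. *)
Record preseminorm q : Prop := Preseminorm {
  sn_ge0 : forall x, D x -> 0 <= q x;
  snD : forall x y, D x -> D y -> q (x + y) <= q x + q y;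
  snZ : forall (c : R[i]) x, D x -> q (c *: x) = cabs c * q x;
  sn_le : forall x, D x -> q x <= cnorm x;
  sn_approx : forall (t : seq A) e, (forall x, x \in t -> D x) -> 0 < e ->
    exists2 T, multiplier T & forall x, x \in t -> `|cnorm (T x) - q x| < e }.

Record cseminorm q : Prop := Cseminorm {
  sn_pre : preseminorm q;
  snM : forall x y, D x -> D y -> q (x ** y) <= q x * q y;
  snC : forall x, D x -> q (star x ** x) = q x ^+ 2 }.

Lemma cseminorm_cnorm : cseminorm (@cnorm R A).
Proof.
split; last 2 first.
- by move=> x y _ _; apply: cnorm_mul.
- by move=> x _; apply: cnorm_starM.
split=> //.
- by move=> x _; apply: cnorm_ge0.
- by move=> x y _ _; apply: cnormD.
- by move=> c x _; apply: cnormZ.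
- by move=> t e _ e0; exists id => // x _; rewrite subrr normr0.
Qed.

Section Infimum.
Variable Q : set (A -> R).
Hypotheses (Q0 : Q !=set0) (preQ : forall q, Q q -> preseminorm q).
Hypothesis dirQ : forall q1 q2, Q q1 -> Q q2 -> exists2 q, Q q &
  forall x, D x -> q x <= q1 x /\ q x <= q2 x.

Definition infsn x : R := inf [set q x | q in Q].

Lemma infsn_has_inf x : D x -> has_inf [set q x | q in Q].
Proof.
move=> Dx; split; first by have [q Qq] := Q0; exists (q x), q.
by exists 0 => _ [q Qq <-]; apply: (sn_ge0 (preQ Qq)).
Qed.

Lemma infsn_le q x : Q q -> D x -> infsn x <= q x.
Proof. by move=> Qq Dx; apply: ge_inf; [case: (infsn_has_inf Dx)|exists q]. Qed.

Lemma infsn_lb x (c k : R) : D x -> 0 <= k -> (forall q, Q q -> c <= k * q x) ->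
  c <= k * infsn x.
Proof.
move=> Dx; rewrite le_eqVlt => /predU1P[<-|k0] ck.
  by have [q Qq] := Q0; have := ck q Qq; rewrite !mul0r.
rewrite mulrC -ler_pdivrMr//; apply: lb_le_inf.
  by case: (infsn_has_inf Dx).
by move=> _ [q Qq <-]; rewrite ler_pdivrMr// mulrC ck.
Qed.

Lemma infsn_ge x c : D x -> (forall q, Q q -> c <= q x) -> c <= infsn x.
Proof.
by move=> Dx cq; rewrite -[leRHS]mul1r; apply: infsn_lb => // q; rewrite mul1r; apply: cq.
Qed.

(** Directedness merges the witnesses for single points one at a time. The common [q] is what
    carries subadditivity and approximation by multipliers over to the infimum. *)
Lemma infsn_approx (t : seq A) (e : R) : (forall x, x \in t -> D x) -> 0 < e ->
  exists2 q, Q q & forall x, x \in t -> q x < infsn x + e.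
Proof.
move=> + e0; elim: t => [_|x t IH tD]; first by have [q Qq] := Q0; exists q.
have Dx : D x by apply: tD; rewrite mem_head.
have [y|q1 Qq1 tq1] := IH; first by move=> yt; apply: tD; rewrite in_cons yt orbT.
have [_ [q2 Qq2 <-] xq2] := inf_adherent e0 (infsn_has_inf Dx).
have [q Qq qle] := dirQ Qq1 Qq2; exists q => // y.
rewrite in_cons => /predU1P[->|yt]; first exact: le_lt_trans (qle _ Dx).2 xq2.
have Dy : D y by apply: tD; rewrite in_cons yt orbT.
exact: le_lt_trans (qle _ Dy).1 (tq1 _ yt).
Qed.

Lemma infsn_ge0 x : D x -> 0 <= infsn x.
Proof. by move=> Dx; apply: infsn_ge => // q Qq; apply: (sn_ge0 (preQ Qq)). Qed.

Lemma le_mul_eps (a b c : R) : 0 <= a -> 0 <= b ->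
  (forall e, 0 < e -> c <= (a + e) * (b + e)) -> c <= a * b.
Proof.
move=> a0 b0 h; rewrite leNgt; apply/negP => abc.
(* As e <= 1, the product (a + e)(b + e) is at most ab + e(a + b + 1), which is less than ab + e(a +
   b + 2) <= c. *)
pose e := Num.min 1 ((c - a * b) / (a + b + 2)).
have s0 : 0 < a + b + 2 by lra.
have e0 : 0 < e by rewrite lt_min ltr01 divr_gt0 ?subr_gt0.
have e1 : e <= 1 by rewrite ge_min lexx.
have e2 : e * (a + b + 2) <= c - a * b by rewrite -ler_pdivlMr// ge_min lexx orbT.
have := h e e0; nra.
Qed.

Lemma preseminorm_infsn : preseminorm infsn.
Proof.
split.
- exact: infsn_ge0.
- move=> x y Dx Dy; apply/ler_addgt0Pr => e e0.
  have e2 : 0 < e / 2 by rewrite divr_gt0.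
  have [z|q Qq qle] := @infsn_approx [:: x; y] _ _ e2.
    by rewrite !inE => /orP[] /eqP ->.
  have := qle x; have := qle y; rewrite !inE !eqxx orbT => /(_ isT) + /(_ isT).
  have := infsn_le Qq (DD Dx Dy); have := snD (preQ Qq) Dx Dy; lra.
- move=> c x Dx; apply/eqP; rewrite eq_le; apply/andP; split.
    apply: infsn_lb; rewrite ?cabs_ge0// => q Qq.
    by rewrite -(snZ (preQ Qq))// infsn_le//; apply: DZ.
  apply: infsn_ge => [|q Qq]; first exact: DZ.
  by rewrite (snZ (preQ Qq))// ler_wpM2l ?cabs_ge0// infsn_le.
- move=> x Dx; have [q Qq] := Q0.
  by rewrite (le_trans (infsn_le Qq Dx))// (sn_le (preQ Qq)).
- move=> t e tD e0; have e2 : 0 < e / 2 by rewrite divr_gt0.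
  have [q Qq qle] := infsn_approx tD e2.
  have [T mT Tle] := sn_approx (preQ Qq) tD e2.
  exists T => // x xt; have := Tle x xt; have := qle x xt.
  have := infsn_le Qq (tD _ xt); rewrite !ltr_norml => ? ? /andP[? ?].
  by apply/andP; split; lra.
Qed.

Hypothesis mulQ : forall q, Q q -> exists2 q', Q q' &
  [/\ forall x, D x -> q' x <= q x,
      forall x y, D x -> D y -> q' (x ** y) <= q x * q y &
      forall x, D x -> q' (star x ** x) = q x ^+ 2].

(** Members of [Q] may fail to be submultiplicative; by [mulQ] another member repairs this, and the
    infimum absorbs the change. For the family [stepsn] below, the repair is the passage from n to
    2n. *)
Lemma cseminorm_infsn : cseminorm infsn.
Proof.
split; first exact: preseminorm_infsn.
- move=> x y Dx Dy; apply: le_mul_eps; rewrite ?infsn_ge0// => e e0.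
  have [z|q Qq qle] := @infsn_approx [:: x; y] _ _ e0.
    by rewrite !inE => /orP[] /eqP ->.
  have := qle x; have := qle y; rewrite !inE !eqxx orbT => /(_ isT) qy /(_ isT) qx.
  have [q' Qq' [_ qM _]] := mulQ Qq.
  rewrite (le_trans (infsn_le Qq' (DM Dx Dy)))// (le_trans (qM _ _ Dx Dy))//.
  by rewrite ler_pM ?(sn_ge0 (preQ Qq)) 1?ltW.
- move=> x Dx; have DC := DM (DJ Dx) Dx.
  apply/eqP; rewrite eq_le; apply/andP; split.
    rewrite expr2; apply: le_mul_eps; rewrite ?infsn_ge0// => e e0.
    have [z|q Qq qle] := @infsn_approx [:: x] _ _ e0; first by rewrite !inE => /eqP ->.
    have := qle x; rewrite !inE eqxx => /(_ isT) qx.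
    have [q' Qq' [_ _ qC]] := mulQ Qq.
    rewrite (le_trans (infsn_le Qq' DC))// qC// expr2.
    by rewrite ler_pM ?(sn_ge0 (preQ Qq)) 1?ltW.
  apply: infsn_ge => // q Qq; have [q' Qq' [q'q _ qC]] := mulQ Qq.
  rewrite (le_trans _ (q'q _ DC))// qC//.
  by rewrite lerXn2r ?nnegrE ?infsn_ge0 ?(sn_ge0 (preQ Qq))// infsn_le.
Qed.

End Infimum.

Lemma iter_cmul_add h n m x : iter n (cmul h) (iter m (cmul h) x) = iter (n + m) (cmul h) x.
Proof. by rewrite iterD. Qed.

Lemma iter_cmulM h n x y : iter n (cmul h) (x ** y) = iter n (cmul h) x ** y.
Proof. by elim: n => //= n ->; rewrite cmulA. Qed.

Lemma iter_cmulMr h n x y : D h -> D x -> D y ->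
  iter n (cmul h) (x ** y) = x ** iter n (cmul h) y.
Proof.
move=> Dh Dx Dy; rewrite commD// iter_cmulM commD//; exact: csub_iter.
Qed.

Lemma iter_cmulD h n x y : iter n (cmul h) (x + y) = iter n (cmul h) x + iter n (cmul h) y.
Proof. by elim: n => //= n ->; rewrite cmulDr. Qed.

Lemma iter_cmulZ h n (c : R[i]) x : iter n (cmul h) (c *: x) = c *: iter n (cmul h) x.
Proof. by elim: n => //= n ->; rewrite cscaleAr. Qed.

Lemma star_iter_cmul h n x : D h -> D x -> star h = h ->
  star (iter n (cmul h) x) = iter n (cmul h) (star x).
Proof.
move=> Dh Dx sh; elim: n => //= n <-; rewrite starM sh commD//.
by apply: DJ; apply: csub_iter.
Qed.

Section Step.
Variables (q : A -> R) (h : A).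
Hypotheses (snq : cseminorm q) (Dh : D h) (sah : star h = h) (q0 : 0 < q h).

(** These seminorms decrease with n, and evaluating one at h x gives [q h] times the next one at x.
    Hence their infimum turns multiplication by [h] into exact dilation by [q h]. *)
Definition stepsn n x : R := q (iter n (cmul h) x) / q h ^+ n.

Lemma stepsn_ge0 n x : D x -> 0 <= stepsn n x.
Proof.
move=> Dx; rewrite divr_ge0 ?exprn_ge0 ?(ltW q0)//.
by rewrite (sn_ge0 (sn_pre snq))//; apply: csub_iter.
Qed.

Lemma stepsnS n x : D x -> stepsn n.+1 x <= stepsn n x.
Proof.
move=> Dx; rewrite /stepsn exprS invfM mulrA ler_pM2r ?invr_gt0 ?exprn_gt0//.
rewrite ler_pdivrMr// mulrC (snM snq)//; exact: csub_iter.
Qed.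

Lemma stepsn_mono n m x : D x -> (n <= m)%N -> stepsn m x <= stepsn n x.
Proof.
move=> Dx /subnK <-; elim: (m - n)%N => // k IH.
by rewrite addSn (le_trans (stepsnS _ Dx)).
Qed.

Lemma stepsn_le n x : D x -> stepsn n x <= q x.
Proof.
by move=> Dx; have := stepsn_mono Dx (leq0n n); rewrite /stepsn /= expr0 divr1.
Qed.

(** By commutativity the 2n factors [h] are shared out, n to each of [x] and [y]. *)
Lemma stepsn_mul n x y : D x -> D y -> stepsn (n + n) (x ** y) <= stepsn n x * stepsn n y.
Proof.
move=> Dx Dy; rewrite /stepsn mulrACA -invfM -exprD ler_pM2r ?invr_gt0 ?exprn_gt0//.
rewrite -iter_cmul_add iter_cmulMr// iter_cmulM (snM snq)//; exact: csub_iter.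
Qed.

Lemma stepsn_star n x : D x -> stepsn (n + n) (star x ** x) = stepsn n x ^+ 2.
Proof.
move=> Dx; rewrite /stepsn expr2 mulrACA -invfM -exprD; congr (_ / _).
rewrite -expr2 -(snC snq) ?star_iter_cmul//; last exact: csub_iter.
by rewrite -iter_cmul_add iter_cmulMr ?iter_cmulM//; apply: DJ.
Qed.

Lemma stepsn_pre n : preseminorm (stepsn n).
Proof.
have pq := sn_pre snq; have k0 : 0 < q h ^+ n by rewrite exprn_gt0.
split.
- exact: stepsn_ge0.
- move=> x y Dx Dy; rewrite /stepsn -mulrDl ler_pM2r ?invr_gt0// iter_cmulD.
  by apply: (snD pq); apply: csub_iter.
- move=> c x Dx; rewrite /stepsn iter_cmulZ (snZ pq) ?mulrA//; exact: csub_iter.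
- by move=> x Dx; rewrite (le_trans (stepsn_le _ Dx))// (sn_le pq).
- move=> t e tD e0.
  have [_ /mapP[x xt ->]||T mT Tle] :=
    sn_approx pq (t := [seq iter n (cmul h) x | x <- t]) (e := e * q h ^+ n).
  + by apply: csub_iter => //; apply: tD.
  + by rewrite mulr_gt0.
  (* A multiplier approximating [q] is precomposed with multiplication by the n-th power of [h] and
     rescaled; the rescaling accounts for the tolerance e q(h)^n used above. *)
  exists (fun x => (q h ^+ n)^-1%:C%C *: T (iter n (cmul h) x)).
    split.
    * by move=> x Dx; apply/DZ/(multD mT)/csub_iter.
    * move=> x y Dx Dy; rewrite iter_cmulD (mult_add mT) ?scalerDr//; exact: csub_iter.
    * move=> c x Dx; rewrite iter_cmulZ (mult_scale mT); last exact: csub_iter.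
      by rewrite !scalerA mulrC.
    * move=> x y Dx Dy; rewrite iter_cmulMr// (mult_mul mT) ?cscaleAr//; exact: csub_iter.
  move=> x xt; have := Tle _ (map_f _ xt).
  have k1 : 0 < (q h ^+ n)^-1 by rewrite invr_gt0.
  rewrite cnormZ cabs_real (gtr0_norm k1) /stepsn => Tx.
  by rewrite mulrC -mulrBl normrM (gtr0_norm k1) -ltr_pdivlMr// invrK.
Qed.

Definition stepinf := infsn (range stepsn).

Let Q0 : range stepsn !=set0.
Proof. by exists (stepsn 0), 0%N. Qed.

Let preQ p : range stepsn p -> preseminorm p.
Proof. by move=> [n _ <-]; apply: stepsn_pre. Qed.

Lemma stepinf_le x : D x -> stepinf x <= q x.
Proof.
move=> Dx; apply: (le_trans (y := stepsn 0 x)); last exact: stepsn_le.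
by apply: infsn_le => //; exists 0%N.
Qed.

Lemma cseminorm_stepinf : cseminorm stepinf.
Proof.
apply: cseminorm_infsn => //.
- move=> _ _ [n _ <-] [m _ <-]; exists (stepsn (n + m)); first by exists (n + m)%N.
  by move=> x Dx; split; apply: stepsn_mono; rewrite ?leq_addr ?leq_addl.
- move=> _ [n _ <-]; exists (stepsn (n + n)); first by exists (n + n)%N.
  split=> [x Dx|x y|x]; [|exact: stepsn_mul|exact: stepsn_star].
  by apply: stepsn_mono; rewrite ?leq_addr.
Qed.

Lemma stepinf_mul x : D x -> stepinf (h ** x) = q h * stepinf x.
Proof.
move=> Dx; have Dhx := DM Dh Dx.
have E n : stepsn n (h ** x) = q h * stepsn n.+1 x.
  rewrite /stepsn -iterSr exprS invfM mulrCA mulrA -mulrA.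
  by rewrite [X in _ = _ * X]mulrA mulfV ?mul1r// gt_eqF.
apply/eqP; rewrite eq_le; apply/andP; split.
  apply: infsn_lb; rewrite ?ltW// => _ [n _ <-].
  apply: le_trans (_ : q h * stepsn n.+1 x <= _).
    by rewrite -E; apply: infsn_le => //; exists n.
  by rewrite ler_pM2l// stepsnS.
apply: infsn_ge => // _ [n _ <-]; rewrite E ler_pM2l//.
by apply: infsn_le => //; exists n.+1.
Qed.

(** Put p_n = q(h^(n+1)). Submultiplicativity and the C*-identity give p_(n+1)^2 <= p_(n+2) p_n, so
    the ratios of consecutive terms increase. The first ratio is q(h), hence p_n >= q(h)^(n+1). *)
Lemma stepinf_self : q h <= stepinf h.
Proof.
have pq := sn_pre snq; have Dn n := csub_iter n Dh Dh.
pose p n := q (iter n (cmul h) h).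
have p_gt n : 0 < p n /\ q h * p n <= p n.+1.
  elim: n => [|n [pn pS]].
    split=> //; by rewrite /p /= -{3}sah (snC snq)// expr2.
  have pS0 : 0 < p n.+1 by rewrite (lt_le_trans _ pS)// mulr_gt0.
  split=> //; have : p n.+1 ^+ 2 <= p n.+2 * p n.
    rewrite /p -(snC snq)// star_iter_cmul// sah.
    have -> : iter n.+1 (cmul h) h ** iter n.+1 (cmul h) h =
              iter n.+2 (cmul h) h ** iter n (cmul h) h.
      rewrite [in LHS]iterS -cmulA -iterS (commD (Dn n) (Dn n.+1)).
      by rewrite cmulA -iterS.
    exact: (snM snq).
  move=> pS2; rewrite -(ler_pM2r pn); apply: le_trans pS2.
  by rewrite mulrAC expr2 ler_pM2r.
apply: infsn_ge => // _ [n _ <-]; rewrite /stepsn ler_pdivlMr ?exprn_gt0// -exprS.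
elim: n => [|n IH]; first by rewrite expr1.
by rewrite exprS (le_trans _ (p_gt n).2)// ler_pM2l.
Qed.

End Step.
End Seminorms.

(** * Minimal C*-seminorms, modulo which every element acts as a scalar *)

Section Characters.
Variables (R : realType) (A : cstarAlgType R) (D : set A).
Hypotheses (subD : cstar_subalgebra D) (commD : abelian D).
Implicit Types (x y z h s : A) (q : A -> R).

Let DD := csubD subD.
Let DZ := csubZ subD.
Let DM := csubM subD.
Let DJ := csubJ subD.
Let DB := csubB subD.

Lemma half_add x : (2^-1 : R[i]) *: (x + x) = x.
Proof.
by rewrite -{1 2}[x]scale1r -scalerDl scalerA mulVf ?scale1r// pnatr_eq0.
Qed.

Section Minimal.
Variable d : A.
Hypotheses (Dd : D d) (sad : star d = d) (d0 : d != 0).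

(** [peak_self] keeps a minimal seminorm from collapsing to zero. [peak_mul] makes it survive a
    step: |d| p(h) = p(d h) <= p(d) p(h) for the new seminorm p, and p(h) > 0 can be cancelled. *)
Record peaking q : Prop := Peaking {
  peak_sn : cseminorm D q;
  peak_mul : forall x, D x -> q (d ** x) = cnorm d * q x;
  peak_self : cnorm d <= q d }.

Lemma peaking_step q h : peaking q -> D h -> star h = h -> 0 < q h ->
  peaking (stepinf q h).
Proof.
move=> [sn qm qd] Dh sah h0; have sn' := cseminorm_stepinf subD commD sn Dh sah h0.
have dm x : D x -> stepinf q h (d ** x) = cnorm d * stepinf q h x.
  move=> Dx; have E n : stepsn q h n (d ** x) = cnorm d * stepsn q h n x.
    by rewrite /stepsn (iter_cmulMr subD)// qm ?mulrA//; apply: csub_iter.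
  have Q0 : range (stepsn q h) !=set0 by exists (stepsn q h 0), 0%N.
  have preQ p : range (stepsn q h) p -> preseminorm D p.
    by move=> [n _ <-]; apply: stepsn_pre.
  apply/eqP; rewrite eq_le; apply/andP; split.
    apply: (infsn_lb Q0 preQ) => //; first exact: cnorm_ge0.
    by move=> _ [n _ <-]; rewrite -E; apply: (infsn_le Q0 preQ); [exists n|apply: DM].
  apply: (infsn_ge Q0 preQ); first exact: DM.
  move=> _ [n _ <-]; rewrite E ler_wpM2l ?cnorm_ge0//.
  by apply: (infsn_le Q0 preQ) => //; exists n.
split=> //; have hq : 0 < stepinf q h h.
  exact: lt_le_trans h0 (stepinf_self subD commD sn Dh sah h0).
by rewrite -(ler_pM2r hq) -dm// (snM sn').
Qed.

Lemma peaking0 : exists q, peaking q.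
Proof.
have h0 : 0 < cnorm d by rewrite cnorm_gt0.
have sn := cseminorm_cnorm D.
exists (stepinf (@cnorm R A) d); split.
- exact: cseminorm_stepinf.
- exact: (stepinf_mul subD).
- exact: (stepinf_self subD).
Qed.

(** Zorn's lemma: the pointwise infimum of a nonempty chain is again peaking. *)
Lemma peaking_minimal : exists2 q, peaking q &
  forall p, peaking p -> (forall x, D x -> p x <= q x) -> forall x, D x -> q x <= p x.
Proof.
have [q0 pq0] := peaking0.
pose T := {q : A -> R | peaking q}.
(* The order is reversed, so that a maximal element is a pointwise minimal seminorm. *)
pose le (p q : T) := `[< forall x, D x -> sval q x <= sval p x >].
have [||C Ctot|[q pq] qmin] := @ZL_preorder T (exist _ q0 pq0) le.
- by move=> p; apply/asboolP.
- move=> r s t /asboolP rs /asboolP st; apply/asboolP => x Dx.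
  exact: le_trans (st _ Dx) (rs _ Dx).
(* The empty chain is bounded by the initial seminorm, its infimum being meaningless. *)
- have [C0|/existsNP[p0 /contrapT Cp0]] := pselect (forall p, ~ C p).
    by exists (exist _ q0 pq0) => p /C0.
  pose Q := [set sval p | p in C].
  have Q0 : Q !=set0 by exists (sval p0), p0.
  have peakQ p : Q p -> peaking p by move=> [[r pr] _ <-].
  have preQ p : Q p -> preseminorm D p by move/peakQ/peak_sn/sn_pre.
  have snQ : cseminorm D (infsn Q).
    apply: (cseminorm_infsn subD) => //.
      move=> _ _ [p Cp <-] [r Cr <-].
      case: (Ctot _ _ Cp Cr) => /asboolP h.
        by exists (sval r); [exists r|move=> x Dx; split=> //; apply: h].
      by exists (sval p); [exists p|move=> x Dx; split=> //; apply: h].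
    move=> p Qp; exists p => //; have sn := peak_sn (peakQ p Qp).
    by split=> //; [exact: snM sn|exact: snC sn].
  have pQ : peaking (infsn Q).
    split=> //.
      move=> x Dx; apply/eqP; rewrite eq_le; apply/andP; split.
        apply: (infsn_lb Q0 preQ) => //; first exact: cnorm_ge0.
        move=> p Qp; rewrite -(peak_mul (peakQ _ Qp))//.
        by apply: (infsn_le Q0 preQ) => //; apply: DM.
      apply: (infsn_ge Q0 preQ); first exact: DM.
      move=> p Qp; rewrite (peak_mul (peakQ _ Qp))// ler_wpM2l ?cnorm_ge0//.
      exact: (infsn_le Q0 preQ).
    by apply: (infsn_ge Q0 preQ) => // p /peakQ /peak_self.
  exists (exist _ _ pQ) => p Cp; apply/asboolP => x Dx /=.
  by apply: (infsn_le Q0 preQ) => //; exists p.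
exists q => // p pp pleq x Dx.
have /asboolP/(_ x Dx) := qmin (exist _ p pp) (introT (asboolP _) pleq).
by [].
Qed.

End Minimal.

Section Isometry.
Variables (q : A -> R).
Hypothesis snq : cseminorm D q.
Let pq := sn_pre snq.

Lemma sn_sub x y : D x -> D y -> q (x - y) <= q x + q y.
Proof.
move=> Dx Dy; rewrite (le_trans (snD pq Dx (csubN subD Dy)))//.
by rewrite -scaleN1r (snZ pq)// /cabs normrN1 mul1r.
Qed.

(** Expanding star (x + c y) ** (x + c y), the cross term carries the factor c + c^*, which vanishes
    for c = i and c = -i; the C*-identity concludes. *)
Lemma sn_normal x y : D x -> D y -> star x ** y = star y ** x ->
  q (x + 'i *: y) = q (x - 'i *: y).
Proof.
move=> Dx Dy xy; have DiY := DZ 'i Dy.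
have [D1 D2] := (DD Dx DiY, DB Dx DiY).
apply/eqP; rewrite -(@eqrXn2 _ 2) ?(sn_ge0 pq)// -!(snC snq)//; apply/eqP; congr q.
have E (c : R[i]) : star (x + c *: y) ** (x + c *: y) =
    star x ** x + (c^* * c)%R *: (star y ** y) + (c + c^*)%R *: (star x ** y).
  rewrite starD starZ !cmulDl !cmulDr !cscaleAl !cscaleAr scalerA -xy scalerDl.
  by rewrite -!addrA; congr (_ + _); rewrite addrA addrC.
have conj_i : ('i^* = - 'i :> R[i])%R := conjCi _.
have conj_Ni : ((- 'i)^* = 'i :> R[i])%R by rewrite rmorphN /= conj_i opprK.
by rewrite -scaleNr !E conj_i conj_Ni mulNr mulrN !subrr addNr.
Qed.

(** With b = i s x and c = s s x, [sn_normal] gives x - c + 2b and x - c - 2b the same seminorm as x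
    + c. Their difference is 4b and q(b) = q(x), so the triangle inequality yields 4 q(x) <= 2 q(x +
    c). *)
Lemma sn_isometry_ge s x : D s -> star s = s ->
  (forall y, D y -> q (s ** y) = q y) -> D x ->
  2 * q x <= q (x + s ** (s ** x)).
Proof.
move=> Ds sas iso Dx; have Dsx := DM Ds Dx.
have key y : D y -> q (y + 'i *: (s ** y)) = q (y - 'i *: (s ** y)).
  move=> Dy; apply: sn_normal => //; first exact: DM.
  by rewrite starM sas !cmulA.
have [b bE] : exists b, b = 'i *: (s ** x) by eexists.
have [c cE] : exists c, c = s ** (s ** x) by eexists.
have Db : D b by rewrite bE; apply: DZ.
have Dc : D c by rewrite cE; apply: DM.
have sb : 'i *: (s ** b) = - c.
  by rewrite bE cE cscaleAr scalerA -expr2 sqrCi scaleN1r.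
have k1 := key _ (DB Dx Db); have k2 := key _ (DD Dx Db).
rewrite cmulBr scalerBr sb -bE opprK addrA subrK in k1.
rewrite cmulDr scalerDr sb -bE opprD opprK [in RHS]addrA addrK in k2.
have e1 : x - b - (b + c) = x - c - (b + b).
  by rewrite opprD (addrC (- b) (- c)) addrACA opprD.
have e2 : x + b + (b - c) = x - c + (b + b) by rewrite (addrC b (- c)) addrACA.
have e3 : x - c + (b + b) - (x - c - (b + b)) = 4%:R *: b.
  rewrite opprB addrC addrA subrK scaler_nat !mulrS mulr0n addr0.
  by rewrite !addrA.
have Dxc := DB Dx Dc; have Dbb := DD Db Db.
have := sn_sub (DD Dxc Dbb) (DB Dxc Dbb).
have normi : cabs ('i : R[i]) = 1 by rewrite /cabs normCi.
rewrite e3 -e1 -e2 k2 -k1 (snZ pq)// bE (snZ pq _ (DM Ds Dx)) iso//.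
by rewrite normi /cabs normr_nat -cE /=; lra.
Qed.

Lemma sn_isometry_sqr_bound m s x : D s -> star s = s ->
  (forall y, D y -> q (s ** y) = q y) -> D x ->
  2 ^+ m * q (x - s ** (s ** x)) <= 2 * q x.
Proof.
move=> + + + Dx; elim: m s => [|m IH] s Ds sas iso; have Dsx := DM Ds Dx.
  have := sn_sub Dx (DM Ds Dsx); rewrite !iso//; lra.
have Dss := DM Ds Ds.
have := IH (s ** s) Dss; rewrite starM sas => /(_ erefl) h.
have Dy := DB Dx (DM Ds Dsx).
have ge := sn_isometry_ge Ds sas iso Dy.
apply: le_trans (h _); last by move=> y Dy'; rewrite -cmulA !iso//; apply: DM.
rewrite exprSr -mulrA ler_pM2l ?exprn_gt0//; apply: le_trans ge _.
by rewrite !cmulBr -!cmulA addrA subrK.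
Qed.

(* With [t_m = q (x - s^(2^m) x)], [sn_isometry_ge] gives [t_(m+1) >= 2 t_m],
   while [t_m <= 2 q x]; so an isometric self-adjoint [s] squares to one. *)
Lemma sn_isometry_sqr s x : D s -> star s = s ->
  (forall y, D y -> q (s ** y) = q y) -> D x -> q (x - s ** (s ** x)) = 0.
Proof.
move=> Ds sas iso Dx; have Dt := DB Dx (DM Ds (DM Ds Dx)).
apply/eqP; rewrite eq_le (sn_ge0 pq)// andbT leNgt; apply/negP => t0.
set t := q _ in t0.
have [m mP] : exists m : nat, 2 * q x < 2 ^+ m * t.
  have h : 0 <= 2 * q x / t by rewrite divr_ge0 ?mulr_ge0 ?(sn_ge0 pq)// ltW.
  exists (Num.bound (2 * q x / t)); rewrite -ltr_pdivrMr//.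
  rewrite (lt_le_trans (archi_boundP h))// -natrX ler_nat.
  by rewrite ltnW// ltn_expl.
by have := sn_isometry_sqr_bound m Ds sas iso Dx; rewrite leNgt mP.
Qed.

Definition sn_scalar x (c : R[i]) : Prop :=
  forall y, D y -> q (x ** y - c *: y) = 0.

Lemma sn_eq0D x y : D x -> D y -> q x = 0 -> q y = 0 -> q (x + y) = 0.
Proof.
move=> Dx Dy x0 y0; apply/eqP; rewrite eq_le (sn_ge0 pq (DD Dx Dy)) andbT.
by rewrite (le_trans (snD pq Dx Dy))// x0 y0 addr0.
Qed.

Lemma sn_scalarD x y c e : D x -> D y ->
  sn_scalar x c -> sn_scalar y e -> sn_scalar (x + y) (c + e).
Proof.
move=> Dx Dy xc ye z Dz; rewrite cmulDl scalerDl opprD addrACA.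
have D1 := DB (DM Dx Dz) (DZ c Dz); have D2 := DB (DM Dy Dz) (DZ e Dz).
by apply: sn_eq0D; rewrite ?xc ?ye.
Qed.

Lemma sn_scalarZ x c e : D x -> sn_scalar x c -> sn_scalar (e *: x) (e * c).
Proof.
move=> Dx xc z Dz; have D1 := DB (DM Dx Dz) (DZ c Dz).
by rewrite cscaleAl -scalerA -scalerBr (snZ pq)// xc// mulr0.
Qed.

(** When q(h) is not zero, h / q(h) is self-adjoint and isometric for [q], so by [sn_isometry_sqr]
    its square acts as the identity. *)
Lemma sn_scalar_sqr h : D h -> star h = h ->
  (forall y, D y -> q (h ** y) = q h * q y) ->
  sn_scalar (h ** h) ((q h ^+ 2)%:C)%C.
Proof.
move=> Dh sah hm y Dy; have Dhy := DM Dh Dy; have Dhhy := DM Dh Dhy.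
rewrite -cmulA; have [h0|h0] := eqVneq (q h) 0.
  by rewrite h0 expr0n /= scale0r subr0 hm// h0 mul0r.
have hp : 0 < q h by rewrite lt_def h0 (sn_ge0 pq).
pose r : R[i] := ((q h)^-1)%:C%C.
have rN : cabs r = (q h)^-1 by rewrite cabs_real gtr0_norm ?invr_gt0.
have rr : (q h ^+ 2)%:C%C * (r * r) = 1.
  rewrite /r -!rmorphM /=; have -> : q h ^+ 2 * ((q h)^-1 * (q h)^-1) = 1 by field.
  by [].
have := @sn_isometry_sqr (r *: h) y (DZ r Dh) _ _ Dy.
rewrite starZ sah conj_Creal; last by rewrite complex_real.
move=> /(_ erefl) iso.
have {}iso : q (y - (r *: h) ** ((r *: h) ** y)) = 0.
  apply: iso => z Dz; rewrite cscaleAl (snZ pq _ (DM Dh Dz)) rN hm//.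
  by rewrite mulrA mulVf ?mul1r.
move: iso; rewrite !cscaleAl cscaleAr scalerA => iso.
have -> : h ** (h ** y) - (q h ^+ 2)%:C%C *: y =
    (- (q h ^+ 2)%:C%C) *: (y - (r * r) *: (h ** (h ** y))).
  by rewrite scaleNr scalerBr scalerA rr scale1r opprB.
by rewrite (snZ pq) ?iso ?mulr0//; apply: DB => //; apply: DZ.
Qed.

(** Squares of self-adjoint elements are scalar by [sn_scalar_sqr]. Polarising a self-adjoint [h]
    against g = d d makes g h scalar, and g, itself a nonzero scalar, stands in for the unit and can
    be divided out. Real and imaginary parts give the rest. *)
Lemma sn_scalar_all d : D d -> star d = d -> 0 < q d ->
  (forall h y, D h -> star h = h -> D y -> q (h ** y) = q h * q y) ->
  forall x, D x -> exists c, sn_scalar x c.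
Proof.
move=> Dd sad d0 hm.
have sq h : D h -> star h = h -> sn_scalar (h ** h) ((q h ^+ 2)%:C)%C.
  by move=> Dh sah; apply: sn_scalar_sqr => // y Dy; apply: hm.
pose g := d ** d; have Dg : D g by apply: DM.
have sag : star g = g by rewrite starM sad.
have g0 : ((q d ^+ 2)%:C != 0 :> R[i])%C by rewrite (inj_eq (@complexI _)) sqrf_eq0 gt_eqF.
have gs := sq d Dd sad.
pose S x := D x /\ exists c, sn_scalar x c.
have SD x y : S x -> S y -> S (x + y).
  by move=> [Dx [c xc]] [Dy [e ye]]; split; [exact: DD|exists (c + e); exact: sn_scalarD].
have SZ c x : S x -> S (c *: x).
  by move=> [Dx [e xe]]; split; [exact: DZ|exists (c * e); exact: sn_scalarZ].
have Ssq h : D h -> star h = h -> S (h ** h).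
  by move=> Dh sah; split; [exact: DM|eexists; exact: sq].
have Ssa h : D h -> star h = h -> S h.
  move=> Dh sah; split=> //.
  have [Dgh [c ghc]] : S (g ** h).
    have -> : g ** h = 2^-1 *: ((g + h) ** (g + h) + (-1) *: (g ** g) + (-1) *: (h ** h)).
      rewrite !scaleN1r cmulDl !cmulDr (commD Dh Dg).
      rewrite -[_ + g ** h + _]addrA [_ - g ** g]addrC addKr [g ** h + (_ + _)]addrA addrK.
      by rewrite half_add.
    apply/SZ/SD/SZ/Ssq => //; apply/SD/SZ/Ssq => //; apply: Ssq; first exact: DD.
    by rewrite starD sag sah.
  set e := (_ %:C)%C in g0 gs; exists (c / e) => y Dy.
  have -> : h ** y - (c / e) *: y =
      e^-1 *: ((g ** h ** y - c *: y) - (g ** (h ** y) - e *: (h ** y))).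
    rewrite opprB addrA cmulA addrAC [_ - c *: y - _]addrAC subrr add0r addrC.
    by rewrite scalerBr !scalerA mulVf// scale1r [_ * c]mulrC.
  have Dhy := DM Dh Dy.
  have D1 := DB (DM Dgh Dy) (DZ c Dy); have D2 := DB (DM Dg Dhy) (DZ e Dhy).
  rewrite (snZ pq _ (DB D1 D2)); apply/eqP; rewrite mulf_eq0; apply/orP; right.
  rewrite eq_le (sn_ge0 pq (DB D1 D2)) andbT.
  by rewrite (le_trans (sn_sub D1 D2))// ghc// gs// addr0.
move=> x Dx; suff [_ //] : S x.
have Dsx := DJ Dx.
have ni : ('i : R[i]) != 0 by rewrite neq0Ci.
have -> : x = 2^-1 *: (x + star x) + (2^-1 * - 'i) *: ('i *: (x - star x)).
  rewrite scalerA -mulrA mulNr -expr2 sqrCi opprK mulr1 -scalerDr addrACA subrr addr0.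
  by rewrite half_add.
apply: SD; apply: SZ; apply: Ssa.
- exact: DD.
- by rewrite starD starK addrC.
- by apply: DZ; apply: DB.
- by rewrite starZ starB starK conjCi scaleNr -scalerN opprB.
Qed.

End Isometry.
End Characters.

(** * Approximate eigenvectors at a point, and countable dense sequences *)

Section Points.
Variables (R : realType) (A : cstarAlgType R) (D : set A).
Implicit Types (a b d x y : A) (rho : A -> R[i]).

Record peaks rho (b : nat -> A) : Prop := Peaks {
  peak_in : forall n, D (b n);
  peak_norm : forall n, cnorm (b n) = 1;
  peak_eig : forall a, D a -> aeq (fun n => a ** b n) (fun n => rho a *: b n) }.

Lemma natSinv_lt (e : R) : 0 < e ->
  exists k : nat, forall n, (k <= n)%N -> n.+1%:R^-1 < e.
Proof.
move=> e0; exists (Num.bound e^-1) => n kn.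
have h : 0 <= e^-1 by rewrite invr_ge0 ltW.
rewrite -[ltRHS]invrK ltf_pV2 ?posrE ?invr_gt0//.
by rewrite (lt_le_trans (archi_boundP h))// ler_nat ltnW.
Qed.

Lemma dense_approx (S : set A) a (e : R) : dense S -> 0 < e ->
  exists2 s, S s & cnorm (a - s) < e.
Proof.
move=> dS e0; have e0' : 0 < e%:C%C :> R[i] by rewrite ltcR.
have [s [/= ase Ss]] : (ball a e%:C%C `&` S) !=set0.
  by apply: dS; [exists a; exact: ballxx|exact: ball_open].
by exists s => //; move: ase; rewrite -ball_normE /= cnormE ltcR.
Qed.

Lemma separable_dense_seq : separable A -> D !=set0 ->
  exists2 c : nat -> A, forall i, D (c i) &
    forall a (e : R), D a -> 0 < e -> exists i, cnorm (a - c i) < e.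
Proof.
move=> [S cS dS] [a0 Da0].
have [f Sf] : exists f : nat -> A, forall s, S s -> exists i, f i = s.
  have /pfcard_geP[S0|/unsquash f] := cS; last first.
    by exists f => s Ss; have [n _ <-] := 'surj_f Ss; exists n.
  by exists (fun=> a0) => s; rewrite S0.
(* The index n codes a pair (i, k); the chosen point of [D] lies within 1/(k+1) of [f i] whenever
   [D] has such a point, and is the default [a0] otherwise. *)
have /choice[c cP] (n : nat) : exists c, D c /\
    (forall i k, unpickle n = Some (i, k) ->
      forall a, D a -> cnorm (a - f i) < k.+1%:R^-1 -> cnorm (c - f i) < k.+1%:R^-1).
  case: (unpickle n) => [[i k]|]; last by exists a0; split=> //.
  have [[c [Dc cf]]|nc] := pselect (exists c, D c /\ cnorm (c - f i) < k.+1%:R^-1).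
    by exists c; split=> // _ _ [<- <-].
  exists a0; split=> // _ _ [<- <-] a Da af; exfalso; apply: nc; by exists a.
exists c => [n|a e Da e0]; first by have [] := cP n.
have [k ke] : exists k : nat, k.+1%:R^-1 < e / 2.
  have e2 : 0 < e / 2 by rewrite divr_gt0.
  by have [k kP] := natSinv_lt e2; exists k; apply: kP.
have k0 : 0 < k.+1%:R^-1 :> R by rewrite invr_gt0.
have [s Ss as_] := dense_approx a dS k0.
have [i fi] := Sf s Ss; exists (pickle (i, k)).
have [_ /(_ i k (pickleK _) a Da)] := cP (pickle (i, k)).
rewrite fi => /(_ as_) cs.
rewrite -(subrK s a) -addrA (le_lt_trans (cnormD _ _))// (cnormC s).
by rewrite [ltRHS]splitr ltrD// ?(lt_trans as_)// (lt_trans cs).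
Qed.

End Points.

(** * Existence of points at which a given nonzero element does not vanish *)

Section PeakExists.
Variables (R : realType) (A : cstarAlgType R) (D : set A).
Hypotheses (subD : cstar_subalgebra D) (commD : abelian D).
Hypothesis sepA : separable A.

Let DD := csubD subD.
Let DZ := csubZ subD.
Let DM := csubM subD.
Let DJ := csubJ subD.
Let DB := csubB subD.

Lemma peak_exists_sa (d : A) : D d -> star d = d -> d != 0 ->
  exists rho b, peaks D rho b /\ rho d != 0.
Proof.
move=> Dd sad d0.
have [q pkq qmin] := peaking_minimal subD commD Dd sad d0.
have snq := peak_sn pkq; have pq := sn_pre snq.
have qd : 0 < q d.
  by rewrite (lt_le_trans _ (peak_self pkq))// cnorm_gt0.
(* The step along [h] yields a peaking seminorm below [q]; by minimality it equals [q] on [D], so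
   [q] inherits [stepinf_mul]. *)
have hm h y : D h -> star h = h -> D y -> q (h ** y) = q h * q y.
  move=> Dh sah Dy; have Dhy := DM Dh Dy; have [h0|h0] := eqVneq (q h) 0.
    apply/eqP; rewrite eq_le (le_trans (snM snq Dh Dy)) ?h0 ?mul0r//=.
    exact: (sn_ge0 pq).
  have hp : 0 < q h by rewrite lt_def h0 (sn_ge0 pq).
  have pk := peaking_step subD commD Dd pkq Dh sah hp.
  have E x : D x -> q x = stepinf q h x.
    move=> Dx; apply/eqP; rewrite eq_le (stepinf_le subD commD snq Dh hp)// andbT.
    by apply: (qmin _ pk) => // z Dz; apply: (stepinf_le subD commD).
  by rewrite (E _ Dhy) (E _ Dy) (stepinf_mul subD commD).
have /choice[rho rhoP] : forall a, exists c, D a -> sn_scalar D q a c.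
  move=> a; have [Da|nDa] := pselect (D a); last by exists 0.
  by have [c ac] := sn_scalar_all subD commD snq Dd sad qd hm Da; exists c.
(* Letting both elements act on [d], where [q] is positive, shows that [rho] is contractive; hence
   the eigenvalue relation need only be arranged on a dense sequence. *)
have rho_dist a c : D a -> D c -> cabs (rho a - rho c) <= cnorm (a - c).
  move=> Da Dc; rewrite -(ler_pM2r qd) -(snZ pq)//.
  have -> : (rho a - rho c) *: d = (a - c) ** d - ((a ** d - rho a *: d) - (c ** d - rho c *: d)).
    rewrite cmulBl scalerBl !opprB [RHS]addrC -[RHS]addrA.
    by rewrite [rho a *: d - _ + _]addrA subrK [RHS]addrC [RHS]addrA subrK.
  have [D1 D2] := (DB (DM Da Dd) (DZ (rho a) Dd), DB (DM Dc Dd) (DZ (rho c) Dd)).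
  have D3 := DM (DB Da Dc) Dd.
  rewrite (le_trans (sn_sub subD snq D3 (DB D1 D2)))//.
  have := sn_sub subD snq D1 D2; rewrite !rhoP// addr0 => h.
  have := snM snq (DB Da Dc) Dd; have := sn_le pq (DB Da Dc); nra.
have [||c Dc cP] := @separable_dense_seq _ _ D; [by []|by exists d|].
have /choice[b bP] (n : nat) : exists b, [/\ D b, cnorm b = 1 &
    forall i, (i < n)%N -> cnorm (c i ** b - rho (c i) *: b) < n.+1%:R^-1].
  (* As e <= q(d)/2, the vector [T d] has norm at least q(d)/2; normalising it then turns an error
     below e into one below 1/(n+1). *)
  pose e : R := q d / 2 / n.+1%:R.
  have e0 : 0 < e by rewrite !divr_gt0.
  have ed : e <= q d / 2.
    by rewrite ler_pdivrMr// ler_peMr ?divr_ge0 ?(ltW qd)// ler1n.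
  pose t := d :: [seq c i ** d - rho (c i) *: d | i <- iota 0 n].
  have [x|T mT Tt] := sn_approx pq (t := t) (e := e) _ e0.
    rewrite in_cons => /predU1P[->//|/mapP[i _ ->]].
    by apply: DB; [exact: DM|exact: DZ].
  have DT := multD mT Dd.
  have Td : q d / 2 <= cnorm (T d).
    have := Tt d (mem_head _ _); rewrite ltr_norml => /andP[]; lra.
  have Td0 : 0 < cnorm (T d) by apply: lt_le_trans Td; rewrite divr_gt0.
  pose r : R[i] := ((cnorm (T d))^-1)%:C%C.
  have rN : cabs r = (cnorm (T d))^-1 by rewrite cabs_real gtr0_norm ?invr_gt0.
  exists (r *: T d); split; first exact: DZ.
    by rewrite cnormZ rN mulVf// gt_eqF.
  move=> i ilt; have Dci := Dc i.
  have Ti : cnorm (c i ** T d - rho (c i) *: T d) < e.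
    have it : c i ** d - rho (c i) *: d \in t.
      by rewrite in_cons; apply/orP; right; apply/mapP; exists i; rewrite ?mem_iota.
    have := Tt _ it; rewrite rhoP// subr0 ger0_norm ?cnorm_ge0//.
    rewrite (mult_add mT) ?(mult_mul mT)//; [|exact: DM|by apply: (csubN subD); apply: DZ].
    by rewrite -!scaleNr (mult_scale mT).
  rewrite cscaleAr scalerA [_ * r]mulrC -scalerA -scalerBr cnormZ rN mulrC ltr_pdivrMr//.
  by apply: lt_le_trans Ti _; rewrite /e [q d / 2 / _]mulrC ler_pM2l ?invr_gt0.
exists rho, b; split.
  split=> [n|n|a Da]; [by have [] := bP n|by have [] := bP n|].
  apply/nullP => e e0; have e4 : 0 < e / 4 by rewrite divr_gt0.
  have [i ci] := cP a _ Da e4.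
  have [k kP] := natSinv_lt e4.
  exists (maxn i.+1 k) => n; rewrite geq_max => /andP[ni nk].
  have [Db bN bi] := bP n.
  have h1 := lt_trans (bi i ni) (kP n nk).
  have h3 := rho_dist a (c i) Da (Dc i).
  have -> : a ** b n - rho a *: b n =
     (a - c i) ** b n + (c i ** b n - rho (c i) *: b n) - (rho a - rho (c i)) *: b n.
    by rewrite cmulBl addrA subrK scalerBl opprB addrA subrK.
  have h4 := cnorm_mul (a - c i) (b n).
  have := cnormB ((a - c i) ** b n + (c i ** b n - rho (c i) *: b n)) ((rho a - rho (c i)) *: b n).
  have := cnormD ((a - c i) ** b n) (c i ** b n - rho (c i) *: b n).
  move: h4; rewrite cnormZ bN; lra.
apply/negP => /eqP rd; have := rhoP d Dd d Dd; rewrite rd scale0r subr0 hm//.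
by move/eqP; rewrite mulf_eq0 orbb gt_eqF.
Qed.

(** The self-adjoint case is applied to star d ** d, on which [rho] would vanish if it vanished at
    [d]. *)
Theorem peak_exists (d : A) : D d -> d != 0 ->
  exists rho b, peaks D rho b /\ rho d != 0.
Proof.
move=> Dd d0; have Ddd := DM (DJ Dd) Dd.
have [||rho [b [pb rd]]] := peak_exists_sa Ddd.
- by rewrite starM starK.
- by apply: contra_neq d0; apply: star_mul_eq0.
exists rho, b; split=> //; apply: contra_neq rd => rd.
have bB := bounded_norm1 (peak_norm pb).
apply: (aeq_norm1_scalar (peak_norm pb)).
apply: aeq_trans (aeq_sym (peak_eig pb Ddd)) _.
have h := aeqMl (bounded_cst (star d)) (peak_eig pb Dd).
apply: aeq_trans (aeq_trans (aeq_eq _) h) (aeq_eq _) => n; first by rewrite cmulA.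
by rewrite rd !scale0r cmul0r.
Qed.
End PeakExists.

(** * Norm closures and commutants *)

Section Closed.
Variables (R : realType) (A : cstarAlgType R).
Implicit Types (S : set A) (a b x y : A).

Lemma closure_cnormP S x :
  closure S x <-> forall e : R, 0 < e -> exists2 y, S y & cnorm (x - y) < e.
Proof.
split=> [cSx e e0|h B /nbhs_ballP[e /= e0 eB]].
  have e0' : 0 < e%:C%C :> R[i] by rewrite ltcR.
  have [y [Sy]] := cSx _ (nbhsx_ballx x _ e0').
  by rewrite -ball_normE /= cnormE ltcR; exists y.
have eE : e = (complex.Re e)%:C%C by rewrite RRe_real ?gtr0_real.
have [|y Sy xy] := h (complex.Re e); first by rewrite -ltcR -eE.
by exists y; split=> //; apply: eB; rewrite -ball_normE /= cnormE eE ltcR.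
Qed.

Lemma cnorm_le_eps x (C : R) : (forall e, 0 < e -> cnorm x <= C * e) -> x = 0.
Proof.
move=> h; apply/eqP; rewrite -cnorm_eq0 eq_le cnorm_ge0 andbT.
rewrite leNgt; apply/negP => x0.
have C0 : 0 < `|C| + 1 by rewrite ltr_wpDl.
have e0 : 0 < cnorm x / (`|C| + 1) / 2 by rewrite !divr_gt0.
have := h _ e0; apply/negP; rewrite -ltNge.
apply: (@le_lt_trans _ _ (`|C| * (cnorm x / (`|C| + 1) / 2))).
  by rewrite ler_wpM2r ?ler_norm ?(ltW e0).
rewrite mulrA ltr_pdivrMr// mulrCA ltr_pM2l// ltr_pdivrMr//.
by have := normr_ge0 C; lra.
Qed.

Lemma null_sqr (u : nat -> A) : null (fun n => star (u n) ** u n) -> null u.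
Proof.
move=> /nullP h; apply/nullP => e e0; have [N hN] := h _ (exprn_gt0 2 e0).
by exists N => n /hN; rewrite cnorm_starM ltr_pXn2r// nnegrE ?cnorm_ge0 ?ltW.
Qed.

Lemma null_scaleI (c : R[i]) (u : nat -> A) : c != 0 -> null (fun n => c *: u n) -> null u.
Proof.
by move=> c0 /(nullZ c^-1); apply: null_ext => n; rewrite scalerA mulVf// scale1r.
Qed.

Definition commutant S : set A := [set a | forall s, S s -> a ** s = s ** a].

Lemma commutant_subalgebra S : (forall s, S s -> S (star s)) ->
  cstar_subalgebra (commutant S).
Proof.
move=> SJ; split.
- by move=> s _; rewrite cmul0l cmul0r.
- by move=> a b aS bS s Ss; rewrite cmulDl cmulDr aS ?bS.
- by move=> c a aS s Ss; rewrite cscaleAl cscaleAr aS.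
- by move=> a b aS bS s Ss; rewrite -cmulA bS// cmulA aS// cmulA.
- move=> a aS s Ss; rewrite -[s]starK -!starM; congr star.
  by rewrite aS//; apply: SJ.
- move=> x /closure_cnormP h s Ss; apply/eqP; rewrite -subr_eq0; apply/eqP.
  apply: (@cnorm_le_eps _ (2 * cnorm s)) => e e0; have [y yS xy] := h e e0.
  have -> : x ** s - s ** x = (x - y) ** s - s ** (x - y).
    by rewrite cmulBl cmulBr yS// opprB addrA subrK.
  have := cnormB ((x - y) ** s) (s ** (x - y)).
  have := cnorm_mul (x - y) s; have := cnorm_mul s (x - y).
  have := cnorm_ge0 s; nra.
Qed.

End Closed.

(** * Excising sequences as approximate eigenvectors, and the NEP for normalisers *)

Section Peak.
Variables (R : realType) (A : cstarAlgType R) (D : set A).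
Hypotheses (subD : cstar_subalgebra D) (commD : abelian D).
Implicit Types (a d x y : A) (k l u b : nat -> A).

Let DD := csubD subD.
Let DZ := csubZ subD.
Let DM := csubM subD.
Let DJ := csubJ subD.
Let DB := csubB subD.

Lemma positive_sa (B : set A) a : positive B a -> star a = a.
Proof. by move=> [b _ ->]; rewrite starM starK. Qed.

Lemma positive_in a : positive D a -> D a.
Proof. by move=> [b Db ->]; apply: DM => //; apply: DJ. Qed.

Section Excises.
Variables (rho : A -> R[i]) (k : nat -> A).
Hypothesis exc : excises D rho k.

Lemma excises_in n : D (k n).
Proof. by have [/positive_in] := exc.1 n. Qed.

Lemma excises_bounded : bounded_seq k.
Proof. by apply: bounded_norm1 => n; apply/norm1_cnorm; have [] := exc.1 n. Qed.

(** With k = [k n] and r = [rho a], star (a k - r k) ** (a k - r k) equals star a - r^* applied to k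
    a k - r k k, because k is self-adjoint and commutes with [star a]. *)
Lemma excises_eig a : D a -> aeq (fun n => a ** k n) (fun n => rho a *: k n).
Proof.
move=> Da; have kD := excises_in.
have sak n : star (k n) = k n by have [/positive_sa] := exc.1 n.
apply: null_sqr.
pose C := cnorm (star a) + cabs (rho a)^*.
apply: (@null_le _ _ C _ (fun n => k n ** a ** k n - rho a *: (k n ** k n))); last first.
  exact: exc.2.
move=> n.
have -> : star (a ** k n - rho a *: k n) ** (a ** k n - rho a *: k n) =
    star a ** (k n ** a ** k n - rho a *: (k n ** k n)) -
      (rho a)^* *: (k n ** a ** k n - rho a *: (k n ** k n)).
  rewrite starB starM starZ sak (commD (kD n) (DJ Da)).
  by rewrite cmulBl cscaleAl -!cmulA !cmulBr !cscaleAr.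
rewrite (le_trans (cnormB _ _))// cnormZ mulrDl lerD2r.
exact: cnorm_mul.
Qed.

End Excises.

Section PeakTheory.
Variables (rho : A -> R[i]) (b : nat -> A).
Hypothesis pb : peaks D rho b.

Let bD := peak_in pb.
Let b1 := peak_norm pb.
Let bB := bounded_norm1 b1.
Let bE := peak_eig pb.

Lemma peakD a d : D a -> D d -> rho (a + d) = rho a + rho d.
Proof.
move=> Da Dd; apply: aeq_norm1_scalar b1 _.
apply: aeq_trans (aeq_sym (bE (DD Da Dd))) _.
apply: aeq_trans (aeq_trans (aeq_eq _) (aeqD (bE Da) (bE Dd))) (aeq_eq _) => n.
  by rewrite cmulDl.
by rewrite scalerDl.
Qed.

Lemma peakZ c a : D a -> rho (c *: a) = c * rho a.
Proof.
move=> Da; apply: aeq_norm1_scalar b1 _.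
apply: aeq_trans (aeq_sym (bE (DZ c Da))) _.
apply: aeq_trans (aeq_trans (aeq_eq _) (aeqZ c (bE Da))) (aeq_eq _) => n.
  by rewrite cscaleAl.
by rewrite scalerA.
Qed.

Lemma peakM a d : D a -> D d -> rho (a ** d) = rho a * rho d.
Proof.
move=> Da Dd; apply: aeq_norm1_scalar b1 _.
apply: aeq_trans (aeq_sym (bE (DM Da Dd))) _.
have h1 := aeqMl (bounded_cst a) (bE Dd).
have h2 := aeqZ (rho d) (bE Da).
apply: aeq_trans (aeq_trans (aeq_eq _) h1) (aeq_trans (aeq_eq _) (aeq_trans h2 (aeq_eq _))) => n.
- by rewrite cmulA.
- by rewrite cscaleAr.
- by rewrite scalerA mulrC.
Qed.

(** In a commutative algebra a - rho(a) is normal, so it and its adjoint send [b n] to vectors of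
    equal norm. *)
Lemma peakJ a : D a -> rho (star a) = (rho a)^*.
Proof.
move=> Da; apply: aeq_norm1_scalar b1 _.
apply: aeq_trans (aeq_sym (bE (DJ Da))) _.
apply: (@null_le _ _ 1 _ _ _ (bE Da)) => n.
rewrite mul1r; rewrite -(@ler_pXn2r _ 2)// ?nnegrE ?cnorm_ge0// -!cnorm_starM.
have [Db Dsa] := (bD n, DJ Da); have Dsb := DJ Db.
rewrite le_eqVlt; apply/orP; left; apply/eqP; congr cnorm.
rewrite !starB !starM !starZ conjCK starK !cmulBl !cmulBr !cscaleAl !cscaleAr !scalerA.
have -> : star (b n) ** a ** (star a ** b n) = star (b n) ** star a ** (a ** b n).
  by rewrite -!cmulA; congr (_ ** _); rewrite !cmulA (commD Da Dsa).
rewrite -!cmulA [_^* * _]mulrC !opprB addrACA [RHS]addrACA.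
by rewrite [- _ + - _]addrC.
Qed.

Lemma peak_le a : D a -> cabs (rho a) <= cnorm a.
Proof.
move=> Da; apply/ler_addgt0Pr => e e0.
have /nullP/(_ e e0)[N /(_ N (leqnn N)) h] := bE Da.
have := cnorm_mul a (b N); have := cnormB (a ** b N) (a ** b N - rho a *: b N).
by rewrite opprB subrKC cnormZ b1 !mulr1; lra.
Qed.

Lemma peak_ge0 a : D a -> 0 <= rho (star a ** a).
Proof.
move=> Da; rewrite peakM ?peakJ//; last exact: DJ.
by rewrite mulrC mul_conjC_ge0.
Qed.

(** The elements [b n] need not be positive, which is why they are replaced by star (b n) ** b n;
    commutativity puts the eigenvalue relation between bounded factors. *)
Lemma peak_excises : excises D rho (fun n => star (b n) ** b n).
Proof.
split=> [n|a Da].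
  split; first by exists (b n).
  by apply/norm1_cnorm; rewrite cnorm_starM b1 expr1n.
have bsB := bounded_star bB.
have h := nullMl (bounded_seqM bsB (bounded_seqM bB bsB)) (bE Da).
apply: null_ext h => n.
rewrite cmulBr cscaleAr -!cmulA; congr (star _ ** (b n ** _) - _).
by rewrite !cmulA (commD Da (DJ (bD n))).
Qed.

End PeakTheory.

Section Normaliser.
Hypothesis auD : contains_approximate_unit D.

Lemma approx_unit a (e : R) : 0 < e -> exists u : A,
  [/\ D u, star u = u, cnorm (u ** a - a) < e & cnorm (a ** u - a) < e].
Proof.
move=> e0; have [I [le [u [_ [lr _] _ uD ua]]]] := auD.
have [i /(_ i (lr i))[h1 h2]] := ua a e e0; exists (u i); split=> //.
  by have [] := uD i.
by have [_ /positive_sa] := uD i.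
Qed.

Lemma normaliser_star x : normaliser D x -> normaliser D (star x).
Proof. by move=> [h1 h2]; split=> d Dd; rewrite starK; [apply: h2|apply: h1]. Qed.

Lemma normaliserM x y : normaliser D x -> normaliser D y -> normaliser D (x ** y).
Proof.
move=> [x1 x2] [y1 y2]; split=> d Dd; rewrite starM.
  by have := y1 _ (x1 _ Dd); rewrite !cmulA.
by have := x2 _ (y2 _ Dd); rewrite !cmulA.
Qed.

Lemma normaliserZ c x : normaliser D x -> normaliser D (c *: x).
Proof.
move=> [x1 x2]; split=> d Dd; rewrite starZ !cscaleAl cscaleAr.
  by apply/DZ/DZ/x1.
by apply/DZ/DZ/x2.
Qed.

Lemma normaliser_in d : D d -> normaliser D d.
Proof. by move=> Dd; have Dsd := DJ Dd; split=> e De; apply: DM => //; apply: DM. Qed.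

(** It is the limit of star x ** u ** x along an approximate unit u taken in [D]. *)
Lemma normaliser_starM x : normaliser D x -> D (star x ** x).
Proof.
move=> [x1 _]; apply: (csub_closed subD); apply/closure_cnormP => e e0.
have C0 : 0 < cnorm x + 1 by rewrite ltr_wpDl ?cnorm_ge0.
have [u [Du _ ux _]] := approx_unit x (divr_gt0 e0 C0).
exists (star x ** u ** x); first exact: x1.
rewrite -cmulA -cmulBr (le_lt_trans (cnorm_mul _ _))// cnorm_star cnormC.
move: ux; rewrite ltr_pdivlMr//; have := cnorm_ge0 (u ** x - x); nra.
Qed.

Lemma normaliser_mul_star x : normaliser D x -> D (x ** star x).
Proof. by move=> /normaliser_star/normaliser_starM; rewrite starK. Qed.

Lemma normaliser_comm x d : normaliser D x -> D d ->
  x ** (star x ** d ** x) = d ** x ** (star x ** x).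
Proof.
by move=> Nx Dd; rewrite !cmulA (commD (normaliser_mul_star Nx) Dd) !cmulA.
Qed.

(** If x vanished at star v ** v, then v ** k n would tend to zero. Otherwise l v (star v d v) k = l
    d v (star v v) k is evaluated twice, the scalars coming from [k] on the left-hand side and from
    both [k] and [l] on the right; since l v k does not tend to zero, they agree. *)
Lemma linked_normaliser v (x y : A -> R[i]) : normaliser D v -> linked D v x y ->
  (x (star v ** v) != 0) /\
  forall d, D d -> x (star v ** d ** v) = y d * x (star v ** v).
Proof.
move=> Nv [k [l [ek el nz]]]; have Dvv := normaliser_starM Nv.
have kB := excises_bounded ek; have lB := excises_bounded el.
split=> [|d Dd].
  apply/eqP => xv; apply: nz.
  have : null (fun n => v ** k n).
    apply: null_sqr; have := excises_eig ek Dvv; rewrite xv => h.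
    have /(nullMl (bounded_star kB)) : null (fun n => star v ** v ** k n).
      by apply: aeq_null h _; apply: null_ext (null0 _) => n; rewrite scale0r.
    by apply: null_ext => n; rewrite starM !cmulA.
  by move/(nullMl lB); apply: null_ext => n; rewrite cmulA.
apply/eqP; rewrite -subr_eq0; apply: contrapT => /negP c0; apply: nz.
apply: null_scaleI c0 _.
have Dvdv : D (star v ** d ** v) by apply: (Nv.1).
have h1 := aeqMl (bounded_seqM lB (bounded_cst v)) (excises_eig ek Dvdv).
have h2 := aeqMl (bounded_seqM lB (bounded_cst (d ** v))) (excises_eig ek Dvv).
have h3 := aeqZ (x (star v ** v)) (aeqMr (bounded_seqM (bounded_cst v) kB) (excises_eig el Dd)).
suff : aeq (fun n => x (star v ** d ** v) *: (l n ** v ** k n))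
           (fun n => (y d * x (star v ** v)) *: (l n ** v ** k n)).
  by apply: null_ext => n; rewrite scalerBl.
apply: aeq_trans (aeq_trans (aeq_eq _) (aeq_sym h1)) _ => [n|].
  by rewrite cscaleAr.
apply: aeq_trans (aeq_trans (aeq_eq _) h2) _ => [n|].
  rewrite -!cmulA; congr (l n ** _); rewrite !cmulA.
  by rewrite (commD (normaliser_mul_star Nv) Dd) !cmulA.
apply: aeq_trans (aeq_trans (aeq_eq _) h3) (aeq_eq _) => n.
  rewrite cscaleAr; congr (_ *: _).
  by rewrite !cmulA (commD (excises_in el n) Dd).
by rewrite cscaleAl scalerA mulrC !cmulA.
Qed.

Lemma normaliser_NEP v : normaliser D v -> NEP D v.
Proof.
move=> Nv x y y' _ _ _ /(linked_normaliser Nv)[x0 xy] /(linked_normaliser Nv)[_ xy'].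
by move=> d Dd; apply: (mulIf x0); rewrite -xy// -xy'.
Qed.

End Normaliser.
End Peak.

(** * Finite sums of normalisers and their closure *)

Section Span.
Variables (R : realType) (A : cstarAlgType R).
Implicit Types (S Q : set A) (a x y z t : A).

(** For a set stable under scalars, such as the normalisers, this is the linear span. *)
Inductive sumset S : A -> Prop :=
| sumset0 : sumset S 0
| sumsetD x y of S x & sumset S y : sumset S (x + y).

Lemma sumset_mem S x : S x -> sumset S x.
Proof. by move=> Sx; rewrite -[x]addr0; apply: sumsetD => //; apply: sumset0. Qed.

Lemma sumset_add S x y : sumset S x -> sumset S y -> sumset S (x + y).
Proof.
move=> Sx Sy; elim: Sx => [|a t Sa _ IH]; first by rewrite add0r.
by rewrite -addrA; apply: sumsetD.
Qed.

Lemma sumset_map S (f : A -> A) : f 0 = 0 -> {morph f : x y / x + y} ->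
  (forall x, S x -> sumset S (f x)) -> forall x, sumset S x -> sumset S (f x).
Proof.
move=> f0 fD fS x; elim=> [|a t Sa _ IH]; first by rewrite f0; apply: sumset0.
by rewrite fD; apply: sumset_add => //; apply: fS.
Qed.

Lemma sumset_eq0 S (f : A -> R[i]) : f 0 = 0 -> {morph f : x y / x + y} ->
  (forall x, S x -> f x = 0) -> forall x, sumset S x -> f x = 0.
Proof.
by move=> f0 fD fS x; elim=> // a t Sa _ IH; rewrite fD IH fS// addr0.
Qed.

Lemma sumset_split S Q t : sumset S t -> exists x y,
  [/\ t = x + y, sumset (S `&` Q) x & sumset (S `&` ~` Q) y].
Proof.
elim=> [|a {}t Sa _ [x [y [-> xQ yQ]]]].
  by exists 0, 0; split; [by rewrite addr0|apply: sumset0|apply: sumset0].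
have [Qa|nQa] := pselect (Q a).
  by exists (a + x), y; split=> //; [rewrite addrA|apply: sumsetD].
by exists x, (a + y); split=> //; [rewrite addrCA|apply: sumsetD].
Qed.

Lemma closure_sumset_subalgebra S :
  (forall (c : R[i]) x, S x -> S (c *: x)) -> (forall x y, S x -> S y -> S (x ** y)) ->
  (forall x, S x -> S (star x)) -> cstar_subalgebra (closure (sumset S)).
Proof.
move=> SZ SM SJ.
have sumsetM x y : sumset S x -> sumset S y -> sumset S (x ** y).
  move=> Sx Sy; elim: Sx => [|a t Sa _ IH]; first by rewrite cmul0l; apply: sumset0.
  rewrite cmulDl; apply: sumset_add => //.
  apply: (@sumset_map S (cmul a)) Sy => [|z z'|z Sz]; rewrite ?cmul0r ?cmulDr//.
  exact/sumset_mem/SM.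
split.
- by apply: subset_closure; apply: sumset0.
- move=> a b /closure_cnormP ha /closure_cnormP hb; apply/closure_cnormP => e e0.
  have e2 : 0 < e / 2 by rewrite divr_gt0.
  have [[x Sx ax] [y Sy by_]] := (ha _ e2, hb _ e2).
  exists (x + y); first exact: sumset_add.
  by rewrite opprD addrACA (le_lt_trans (cnormD _ _))//; lra.
- move=> c a /closure_cnormP ha; apply/closure_cnormP => e e0.
  have C0 : 0 < cabs c + 1 by rewrite ltr_wpDl ?cabs_ge0.
  have [x Sx ax] := ha _ (divr_gt0 e0 C0); exists (c *: x).
    apply: (@sumset_map S (GRing.scale c)) Sx => [|z z'|z Sz]; rewrite ?scaler0 ?scalerDr//.
    exact/sumset_mem/SZ.
  rewrite -scalerBr cnormZ; move: ax; rewrite ltr_pdivlMr//.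
  by have := cabs_ge0 c; have := cnorm_ge0 (a - x); nra.
- move=> a b /closure_cnormP ha /closure_cnormP hb; apply/closure_cnormP => e e0.
  have e2 : 0 < e / 2 by rewrite divr_gt0.
  have C0 : 0 < cnorm a + 1 by rewrite ltr_wpDl ?cnorm_ge0.
  (* [y] is fixed before [x], whose tolerance depends on the norm of [y]. *)
  have [y Sy by_] := hb _ (divr_gt0 e2 C0).
  have C1 : 0 < cnorm y + 1 by rewrite ltr_wpDl ?cnorm_ge0.
  have [x Sx ax] := ha _ (divr_gt0 e2 C1); exists (x ** y); first exact: sumsetM.
  have -> : a ** b - x ** y = a ** (b - y) + (a - x) ** y.
    by rewrite cmulBr cmulBl addrA subrK.
  rewrite (le_lt_trans (cnormD _ _))//.
  move: by_ ax; rewrite !ltr_pdivlMr//.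
  have := cnorm_mul a (b - y); have := cnorm_mul (a - x) y.
  have := cnorm_ge0 (b - y); have := cnorm_ge0 (a - x); nra.
- move=> a /closure_cnormP ha; apply/closure_cnormP => e e0.
  have [x Sx ax] := ha _ e0; exists (star x).
    apply: (@sumset_map S (@star R A)) Sx => [|z z'|z Sz]; rewrite ?star0 ?starD//.
    exact/sumset_mem/SJ.
  by rewrite -starB cnorm_star.
- exact: closed_closure.
Qed.

End Span.

(** * Consequences of maximal abelianness, regularity and the conditional expectation *)

Section Cartan.
Variables (R : realType) (A : cstarAlgType R) (D : set A).
Hypotheses (cartanD : cartan_subalgebra D).
Implicit Types (a d f m n p q u v w x y z : A).

Let subD := cartan_subalg cartanD.
Let auD := cartan_approx_unit cartanD.
Let commD := (cartan_max_abelian cartanD).1.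
Let DD := csubD subD.
Let DZ := csubZ subD.
Let DM := csubM subD.
Let DJ := csubJ subD.
Let DB := csubB subD.

(* The bicommutant of [D] and a self-adjoint [h] commuting with [D] is an
   abelian C*-subalgebra. *)
Lemma masa_selfadjoint h : star h = h -> commutant D h -> D h.
Proof.
move=> sah hD; pose S : set A := D `|` [set h].
have SJ s : S s -> S (star s) by move=> [Ds|->]; [left; exact: DJ|right; rewrite /= sah].
have SJ' s : commutant S s -> commutant S (star s).
  by move=> h1; apply: (csubJ (commutant_subalgebra SJ)).
have SS : S `<=` commutant (commutant S) by move=> s Ss t St; rewrite St.
have Sab : S `<=` commutant S.
  move=> s [Ds|->] t [Dt|->] //; first exact: commD.
    by rewrite hD.
  by rewrite hD.
apply: ((cartan_max_abelian cartanD).2 _ (commutant_subalgebra SJ') _ _ h _).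
- move=> a b aE bE; apply: aE => s Ss; apply: bE; exact: Sab.
- by move=> d Dd; apply: SS; left.
- by apply: SS; right.
Qed.

Lemma masa_commutant a : commutant D a -> D a.
Proof.
have cD : cstar_subalgebra (commutant D) by apply: commutant_subalgebra DJ.
move=> aD; have saD := csubJ cD aD.
have -> : a = 2^-1 *: (a + star a) + (2^-1 * - 'i) *: ('i *: (a - star a)).
  rewrite scalerA -mulrA mulNr -expr2 sqrCi opprK mulr1 -scalerDr addrACA subrr addr0.
  by rewrite half_add.
apply: DD; apply: DZ; apply: masa_selfadjoint.
- by rewrite starD starK addrC.
- exact: (csubD cD aD saD).
- by rewrite starZ starB starK conjCi scaleNr -scalerN opprB.
- exact: (csubZ cD 'i (csubB cD aD saD)).
Qed.

Lemma normaliser_dense a (e : R) : 0 < e ->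
  exists2 t, sumset (normaliser D) t & cnorm (a - t) < e.
Proof.
move=> e0; suff /closure_cnormP/(_ e e0) : closure (sumset (normaliser D)) a by [].
suff -> : closure (sumset (normaliser D)) = setT by [].
apply: (cartan_regular cartanD).
  apply: closure_sumset_subalgebra.
  - by move=> c x; apply: (normaliserZ subD).
  - by move=> x y; apply: normaliserM.
  - by move=> x; apply: normaliser_star.
by move=> x Nx; apply: subset_closure; apply: sumset_mem.
Qed.

Section Expectation.
Variable P : {linear A -> A}.
Hypotheses (cexpP : conditional_expectation D P) (faithP : faithful P).

Let PD := cexp_range cexpP.

Lemma cexp_cnorm a : cnorm (P a) <= cnorm a.
Proof. by rewrite -lecR -!cnormE (cexp_contractive cexpP). Qed.

(** Positivity settles elements star x ** x, polarisation settles all products star x ** y, and an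
    approximate unit reduces a general [a] to such products. *)
Lemma cexp_star a : P (star a) = star (P a).
Proof.
pose H a := P (star a) = star (P a).
have HD x y : H x -> H y -> H (x + y) by rewrite /H starD !linearD starD => -> ->.
have HZ (c : R[i]) x : H x -> H (c *: x).
  by rewrite /H starZ !linearZ_LR starZ => ->.
have HP x : H (star x ** x).
  have /positive_sa : positive D (P (star x ** x)).
    by apply: (cexp_positive cexpP); exists x.
  by rewrite /H starM starK => ->.
have HS x y : H (star x ** y + star y ** x).
  have -> : star x ** y + star y ** x =
     star (x + y) ** (x + y) + (-1) *: (star x ** x) + (-1) *: (star y ** y).
    rewrite starD cmulDl !cmulDr !scaleN1r.
    rewrite -(addrA (star x ** x)) [_ + (_ + _) - _]addrC addKr.
    by rewrite addrA addrK.
  by apply: (HD _ _ (HD _ _ _ _) _); [exact: HP|exact/HZ/HP|exact/HZ/HP].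
have HM x y : H (star x ** y).
  have -> : star x ** y = 2^-1 *: ((star x ** y + star y ** x) +
      'i *: (star ('i *: x) ** y + star y ** ('i *: x))).
    rewrite starZ conjCi cscaleAl cscaleAr (scalerDr 'i) !scalerA mulrN -expr2 sqrCi opprK.
    rewrite scale1r scaleN1r addrACA subrr addr0.
    by rewrite half_add.
  by apply/HZ/HD => //; apply: HZ.
apply/eqP; rewrite -subr_eq0; apply/eqP.
apply: (@cnorm_le_eps _ _ _ 2) => e e0.
have [w [Dw sw wa _]] := approx_unit auD a e0.
have := HM w a; rewrite /H sw => Hw.
have -> : P (star a) - star (P a) = star (P (w ** a - a)) - P (star (w ** a - a)).
  by rewrite linearB !starB linearB -Hw opprB [RHS]addrC addrA subrK.
have := cnormB (star (P (w ** a - a))) (P (star (w ** a - a))).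
have := cexp_cnorm (w ** a - a); have := cexp_cnorm (star (w ** a - a)).
rewrite !cnorm_star; lra.
Qed.

(** Otherwise P(t x) = 0 for all t in the closed span of the normalisers, in particular for t =
    [star x], against faithfulness. *)
Lemma faithful_normaliser x : x != 0 -> exists2 n, normaliser D n & P (n ** x) != 0.
Proof.
move=> x0; apply: contrapT => h.
have {}h n : normaliser D n -> P (n ** x) = 0.
  by move=> Nn; apply: contrapT => /eqP Pn; apply: h; exists n.
move/eqP: x0; apply; apply: star_mul_eq0; apply: faithP; first by exists x.
apply: (@cnorm_le_eps _ _ _ (cnorm x)) => e e0.
have [t Nt xt] := normaliser_dense (star x) e0.
have Pt : P (t ** x) = 0.
  elim: Nt {xt} => [|n {}t Nn _ IH]; first by rewrite cmul0l linear0.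
  by rewrite cmulDl linearD IH h// addr0.
rewrite -[P _]subr0 -Pt -linearB -cmulBl (le_trans (cexp_cnorm _))//.
rewrite (le_trans (cnorm_mul _ _))// mulrC ler_wpM2l ?cnorm_ge0//.
exact: ltW.
Qed.

(* If [P q] does not vanish near a point, then [q] acts trivially there, hence
   agrees with [P q] since [D] is maximal abelian. *)
Lemma normaliser_diag q : normaliser D q -> star (P q) ** q = star (P q) ** P q.
Proof.
move=> Nq; set e := P q.
have De : D e by apply: PD.
have Dse := DJ De.
have Dqq := normaliser_starM subD auD Nq; have Dqq' := normaliser_mul_star subD auD Nq.
(* The adjoint of an identity between two evaluations of [P (q f* q* q)]. *)
have key f : D f -> star e ** (q ** f ** star q) = star e ** (q ** star q) ** f.
  move=> Df; have Dsf := DJ Df; have Dqfq : D (q ** star f ** star q) by apply: Nq.2.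
  have h : q ** star f ** star q ** e = q ** star q ** e ** star f.
    rewrite -(cexp_modl cexpP) // -(cexp_modl cexpP) // -(cexp_modr cexpP) //.
    by congr (P _); rewrite -!cmulA; congr (q ** _); rewrite (commD Dsf Dqq) -cmulA.
  have := congr1 star h; rewrite !starM !starK -!cmulA => ->.
  by rewrite (commD Df (DM Dse Dqq')) -!cmulA.
suff De' : D (star e ** q).
  by rewrite -(cexp_id cexpP De') (cexp_modl cexpP).
apply: masa_commutant => f Df; have Dsf := DJ Df.
apply/eqP; rewrite -subr_eq0; apply/eqP.
have -> : star e ** q ** f - f ** (star e ** q) = star e ** (q ** f - f ** q).
  by rewrite cmulBr !cmulA (commD Df Dse).
(* By the C*-identity it suffices to kill star e ** c ** star c ** e, with c the commutator of q and
   f. By [key], each of the four terms in the expansion of star e ** c ** star c is [g] up to sign,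
   and they cancel. *)
rewrite -[LHS]starK -[RHS]star0; congr star; apply: star_mul_eq0.
rewrite starK starM starK cmulA -[_ ** star _]cmulA.
suff -> : star e ** ((q ** f - f ** q) ** star (q ** f - f ** q)) = 0 by rewrite cmul0l.
set g := star e ** (q ** star q) ** (f ** star f).
have e1 : star e ** (q ** f ** (star f ** star q)) = g.
  by rewrite /g -(key _ (DM Df Dsf)) !cmulA.
have e2 : star e ** (q ** f ** (star q ** star f)) = g.
  by rewrite /g [RHS]cmulA -(key _ Df) !cmulA.
have e3 : star e ** (f ** q ** (star f ** star q)) = g.
  rewrite !cmulA (commD Dse Df) -!cmulA [q ** _]cmulA key//.
  by rewrite cmulA (commD Df (DM Dse Dqq')) /g -!cmulA.
have e4 : star e ** (f ** q ** (star q ** star f)) = g.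
  by rewrite /g -!cmulA [q ** (_ ** star f)]cmulA [f ** _]cmulA (commD Df Dqq') -!cmulA.
rewrite starB !starM cmulBl !cmulBr e1 e2 e3 e4.
by rewrite !subrr.
Qed.

End Expectation.
End Cartan.

(** * The state obtained from a point, its GNS form, and images of points under normalisers *)

Section LocalState.
Variables (R : realType) (A : cstarAlgType R) (D : set A).
Hypotheses (cartanD : cartan_subalgebra D).
Implicit Types (a d f m n p q u v w x y z t : A).

Let subD := cartan_subalg cartanD.
Let auD := cartan_approx_unit cartanD.
Let commD := (cartan_max_abelian cartanD).1.
Let DD := csubD subD.
Let DZ := csubZ subD.
Let DM := csubM subD.
Let DJ := csubJ subD.
Let DB := csubB subD.

Variable P : {linear A -> A}.
Hypotheses (cexpP : conditional_expectation D P).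
Variables (rho : A -> R[i]) (b : nat -> A).
Hypothesis pb : peaks D rho b.

Let PD := cexp_range cexpP.
Let bD := peak_in pb.
Let b1 := peak_norm pb.
Let bB := bounded_norm1 b1.
Let bE := peak_eig pb.

(** Positivity makes phi (star x ** y) a semi-inner product in x and y; the GNS space is used only
    through this form. *)
Definition local_state a : R[i] := rho (P a).
Local Notation phi := local_state.

Lemma local_stateD a d : phi (a + d) = phi a + phi d.
Proof. by rewrite /phi linearD (peakD subD pb). Qed.

Lemma local_stateZ c a : phi (c *: a) = c * phi a.
Proof. by rewrite /phi linearZ_LR (peakZ subD pb). Qed.

Lemma local_state0 : phi 0 = 0.
Proof. by rewrite -(scale0r (0 : A)) local_stateZ mul0r. Qed.

Lemma local_stateB a d : phi (a - d) = phi a - phi d.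
Proof. by rewrite local_stateD -scaleN1r local_stateZ mulN1r. Qed.

Lemma local_state_modl d a : D d -> phi (d ** a) = rho d * phi a.
Proof. by move=> Dd; rewrite /phi (cexp_modl cexpP)// (peakM subD pb). Qed.

Lemma local_state_modr d a : D d -> phi (a ** d) = phi a * rho d.
Proof. by move=> Dd; rewrite /phi (cexp_modr cexpP)// (peakM subD pb). Qed.

Lemma local_state_id d : D d -> phi d = rho d.
Proof. by move=> Dd; rewrite /phi (cexp_id cexpP). Qed.

Lemma local_stateJ a : phi (star a) = (phi a)^*.
Proof. by rewrite /phi (cexp_star cartanD cexpP) (peakJ subD commD pb). Qed.

Lemma local_state_ge0 a : 0 <= phi (star a ** a).
Proof.
have [|c Dc pc] := cexp_positive cexpP (a := star a ** a); first by exists a.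
rewrite /phi pc; exact: (peak_ge0 subD commD pb).
Qed.

Lemma local_state_le a : cabs (phi a) <= cnorm a.
Proof.
exact: le_trans (peak_le pb (PD a)) (cexp_cnorm cexpP a).
Qed.

Lemma local_state_sqrE a : phi (star a ** a) = (cabs (phi (star a ** a)))%:C%C.
Proof. by rewrite -cabsE ger0_norm ?local_state_ge0. Qed.

(** Positivity at z - (s / k) star u. Any positive upper bound k is allowed, which covers the
    degenerate case of [u] without a division by zero. *)
Lemma local_state_cauchy_schwarz u z (k : R) : 0 < k -> cabs (phi (u ** star u)) <= k ->
  cabs (phi (u ** z)) ^+ 2 <= k * cabs (phi (star z ** z)).
Proof.
move=> k0 uk; set s := phi (u ** z); set e := phi (u ** star u) in uk.
pose t : R[i] := (k^-1)%:C%C.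
have tJ : t^* = t by rewrite conj_Creal// complex_real.
have [r2 r2E] : exists r, r = cabs e by eexists.
have [r3 r3E] : exists r, r = cabs s by eexists.
have eE : e = r2%:C%C by have := local_state_sqrE (star u); rewrite starK -/e r2E.
have ss : s * s^* = (r3%:C)%C ^+ 2 by rewrite -normCK cabsE r3E.
have := local_state_ge0 (z - (t * s) *: star u).
have [r1 r1E] : exists r, r = cabs (phi (star z ** z)) by eexists.
have zz : phi (star z ** z) = r1%:C%C by rewrite local_state_sqrE r1E.
have zu : phi (star z ** star u) = s^* by rewrite -starM local_stateJ.
have -> : phi (star (z - (t * s) *: star u) ** (z - (t * s) *: star u)) =
    (r1 - 2 * k^-1 * r3 ^+ 2 + k^-1 ^+ 2 * r3 ^+ 2 * r2)%:C%C.
  rewrite starB starZ starK cmulBl !cmulBr !cscaleAl !cscaleAr !scalerA !local_stateB !local_stateZ.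
  rewrite zu -/s -/e rmorphM /= tJ zz eE.
  transitivity (r1%:C%C - 2 * t * (s * s^*) + t ^+ 2 * (s * s^*) * r2%:C%C); first by ring.
  by rewrite ss !(rmorphD, rmorphN, rmorphM, rmorphXn, rmorph_nat).
rewrite ler0c -r1E -r3E => h.
have h2 : k^-1 ^+ 2 * r3 ^+ 2 * r2 <= k^-1 * r3 ^+ 2.
  have -> : k^-1 * r3 ^+ 2 = k^-1 ^+ 2 * r3 ^+ 2 * k by field; rewrite gt_eqF.
  by rewrite ler_wpM2l ?r2E// mulr_ge0 ?sqr_ge0.
by rewrite -ler_pdivrMl//; lra.
Qed.

Lemma local_state_pythagoras z y : phi (star y ** z) = 0 ->
  cabs (phi (star z ** z)) <= cabs (phi (star (z - y) ** (z - y))).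
Proof.
move=> yz; rewrite -lecR -!local_state_sqrE starB cmulBl !cmulBr !local_stateB yz.
have -> : phi (star z ** y) = 0 
  by rewrite -[star z ** y]starK starM starK local_stateJ yz rmorph0.
by rewrite !subr0 sub0r opprK lerDl local_state_ge0.
Qed.

(** If the value were zero, the Cauchy-Schwarz bound would hold with every k > 0. *)
Lemma local_state_normaliser_neq0 n a : normaliser D n -> phi (n ** a) != 0 ->
  rho (n ** star n) != 0.
Proof.
move=> Nn; apply: contra_neq => nn.
have h (k : R) : 0 < k -> cabs (phi (n ** a)) ^+ 2 <= k * cabs (phi (star a ** a)).
  move=> k0; apply: local_state_cauchy_schwarz => //.
  rewrite local_state_id ?nn; last exact: (normaliser_mul_star subD auD).
  by rewrite /cabs normr0 ltW.
apply/eqP; rewrite -cabs_eq0 -sqrf_eq0 eq_le exprn_ge0 ?cabs_ge0// andbT.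
apply/ler_addgt0Pr => e e0; rewrite add0r.
have c0 : 0 < cabs (phi (star a ** a)) + 1 by rewrite ltr_wpDl ?cabs_ge0.
rewrite (le_trans (h _ (divr_gt0 e0 c0)))// mulrAC ler_pdivrMr// ler_pM2l//.
by rewrite lerDl.
Qed.

(** Since f commutes with star n ** n, both sides are phi of one product. Thus f, standing next to
    n, acts as its value at the image of the point under [star n]. *)
Lemma local_state_normaliser n f a : normaliser D n -> D f ->
  rho (n ** star n) * phi (n ** f ** a) = rho (n ** f ** star n) * phi (n ** a).
Proof.
move=> Nn Df; rewrite -!local_state_modl; last first.
- exact: (normaliser_mul_star subD auD).
- exact: Nn.2.
congr phi; rewrite -!cmulA; congr (n ** _); rewrite !cmulA; congr (_ ** a).
by rewrite -[RHS]cmulA (commD Df (normaliser_starM subD auD Nn)).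
Qed.

(* Normalisers that are not orthogonal at the point are proportional there. *)
Lemma local_state_germ m n t : normaliser D m -> normaliser D n ->
  phi (star m ** n) != 0 -> phi (star m ** t) = 0 -> phi (star n ** t) = 0.
Proof.
move=> Nm Nn mn mt.
have [q qE] : exists q, q = star m ** n by eexists.
have Nq : normaliser D q by rewrite qE; apply: normaliserM => //; apply: normaliser_star.
rewrite -qE in mn.
have Nsn := normaliser_star Nn.
have Dmm := normaliser_mul_star subD auD Nm.
(* Through [diag], the vanishing of phi (star m ** t) passes to star n ** (m ** star m) ** t; then
   [local_state_normaliser] extracts m ** star m, at the cost of the nonzero factor
   [rho (star q ** q)]. *)
have diag : P q ** star q = P q ** star (P q).
  have := normaliser_diag cartanD cexpP (normaliser_star Nq).
  by rewrite (cexp_star cartanD cexpP) starK.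
have e1 : phi (P q ** star q ** (star m ** t)) = 0.
  rewrite diag local_state_modl ?mt ?mulr0//; exact: DM (PD _) (DJ (PD _)).
have e2 : phi (star n ** (m ** star m) ** t) = 0.
  move: e1; rewrite -cmulA local_state_modl// => /eqP.
  rewrite mulf_eq0 (negbTE mn) /= => /eqP <-.
  by rewrite qE starM starK !cmulA.
have qq : rho (star q ** q) != 0.
  apply: contra_neq mn => qq0; have Dq := PD q; have DJq := DJ Dq.
  have : phi (P q ** star q ** q) = 0.
    by rewrite -cmulA local_state_modl// local_state_id ?qq0 ?mulr0//; apply: normaliser_starM.
  rewrite diag -cmulA (local_state_modl _ Dq) (local_state_modl _ DJq).
  rewrite (peakJ subD commD pb)// -/(phi q).
  by move/eqP; rewrite !mulf_eq0 conjC_eq0 !orbb => /eqP.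
have := local_state_normaliser t Nsn Dmm; rewrite e2 mulr0 => /esym/eqP.
rewrite mulf_eq0 => /orP[|/eqP//].
rewrite (_ : _ ** _ = star q ** q) ?(negbTE qq)//.
by rewrite qE starM !starK !cmulA.
Qed.

(** Approximate t by a sum y + x of normalisers, those in y not orthogonal to t and those in x
    orthogonal to it. If no [m] existed, u would annihilate y; by [local_state_germ] x is orthogonal
    to y, hence to t - y. So phi(u t) = phi(u (t - y)) is controlled by the norm of t - y, which is
    at most that of t - y - x. *)
Lemma local_state_chain u t : phi (u ** t) != 0 -> exists m,
  [/\ normaliser D m, phi (u ** m) != 0 & phi (star m ** t) != 0].
Proof.
move=> ut; apply: contrapT => nex.
have {}nex m : normaliser D m -> phi (star m ** t) != 0 -> phi (u ** m) = 0.
  move=> Nm mt; apply: contrapT => /eqP um; apply: nex; by exists m.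
move/eqP: ut; apply; apply/eqP; rewrite -cabs_eq0.
rewrite -sqrf_eq0 eq_le exprn_ge0 ?cabs_ge0// andbT.
pose k := cnorm (u ** star u) + 1.
have k0 : 0 < k by rewrite ltr_wpDl ?cnorm_ge0.
have uk : cabs (phi (u ** star u)) <= k by rewrite (le_trans (local_state_le _))// lerDl.
apply/ler_addgt0Pr => e e0; rewrite add0r.
have d0 : 0 < Num.sqrt (e / k) by rewrite sqrtr_gt0 divr_gt0.
have [s Ns ts] := normaliser_dense cartanD t d0.
have [y [x [sE yQ xQ]]] :=
  sumset_split [set m | phi (star m ** t) != 0] Ns.
have uy : phi (u ** y) = 0.
  apply: (sumset_eq0 (f := fun z => phi (u ** z))) yQ => [|z z'|z [Nz zt]].
  - by rewrite cmul0r local_state0.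
  - by rewrite cmulDr local_stateD.
  - exact: nex.
have xt : phi (star x ** t) = 0.
  apply: (sumset_eq0 (f := fun z => phi (star z ** t))) xQ => [|z z'|z [Nz zt]].
  - by rewrite star0 cmul0l local_state0.
  - by rewrite starD cmulDl local_stateD.
  - by apply: contrapT => /eqP.
have xy : phi (star x ** y) = 0.
  apply: (sumset_eq0 (f := fun z => phi (star z ** y))) xQ => [|z z'|z [Nz zt]].
  - by rewrite star0 cmul0l local_state0.
  - by rewrite starD cmulDl local_stateD.
  apply: (sumset_eq0 (f := fun z' => phi (star z ** z'))) yQ => [|z1 z2|z' [Nz' zt']].
  - by rewrite cmul0r local_state0.
  - by rewrite cmulDr local_stateD.
  apply: contrapT => /eqP zz; move/eqP: zt'; apply.
  by apply: local_state_germ zz _ => //; apply: contrapT => /eqP.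
have -> : phi (u ** t) = phi (u ** (t - y)) by rewrite cmulBr local_stateB uy subr0.
apply: le_trans (local_state_cauchy_schwarz _ k0 uk) _.
have xty : phi (star x ** (t - y)) = 0 by rewrite cmulBr local_stateB xt xy subr0.
rewrite mulrC -ler_pdivlMr// (le_trans (local_state_pythagoras xty))//.
rewrite (le_trans (local_state_le _))// cnorm_starM -addrA -opprD -sE.
have ek : 0 <= e / k by rewrite divr_ge0 ?ltW.
rewrite -[leRHS](sqr_sqrtr ek) lerXn2r ?nnegrE ?cnorm_ge0 ?sqrtr_ge0//.
exact: ltW.
Qed.

(** The image of the point under the partial homeomorphism induced by a normaliser [m], meaningful
    where the denominator is nonzero. *)
Definition push m a : R[i] := rho (star m ** a ** m) / rho (star m ** m).

Section Push.
Variable m : A.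
Hypotheses (Nm : normaliser D m) (mm : rho (star m ** m) != 0).

Let Dmm := normaliser_starM subD auD Nm.

Lemma push_eig a : D a -> aeq (fun i => a ** m ** b i) (fun i => push m a *: (m ** b i)).
Proof.
move=> Da; have Dmam : D (star m ** a ** m) by apply: Nm.1.
have h1 := aeqMl (bounded_cst (a ** m)) (bE Dmm).
have h2 := aeqMl (bounded_cst m) (bE Dmam).
have h : aeq (fun i => rho (star m ** m) *: (a ** m ** b i))
             (fun i => rho (star m ** a ** m) *: (m ** b i)).
  apply: aeq_trans (aeq_trans (aeq_eq _) (aeq_sym h1)) _ => [i|].
    by rewrite cscaleAr.
  apply: aeq_trans (aeq_trans (aeq_eq _) h2) (aeq_eq _) => i; last by rewrite cscaleAr.
  by rewrite [LHS]cmulA -(normaliser_comm subD commD auD Nm Da) -cmulA.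
apply: aeq_trans (aeq_trans (aeq_eq _) (aeqZ (rho (star m ** m))^-1 h)) (aeq_eq _) => i.
  by rewrite scalerA mulVf// scale1r.
by rewrite scalerA mulrC.
Qed.

Lemma push_spectrum : spectrum D (push m).
Proof.
have Dc a : D a -> D (star m ** a ** m) by apply: Nm.1.
have Dmm' := normaliser_mul_star subD auD Nm.
split.
- move=> a d Da Dd; rewrite /push cmulDr cmulDl (peakD subD pb) ?mulrDl//; exact: Dc.
- move=> c a Da; rewrite /push cscaleAr cscaleAl (peakZ subD pb) ?mulrA//; exact: Dc.
- move=> a d Da Dd; rewrite /push.
  have : rho (star m ** a ** m) * rho (star m ** d ** m) =
         rho (star m ** (a ** d) ** m) * rho (star m ** m).
    rewrite -!(peakM subD pb)//; [|exact/Dc/DM|exact: Dc|exact: Dc].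
    congr rho; rewrite -!cmulA; congr (star m ** (a ** _)).
    by rewrite !cmulA -(commD Dd Dmm') !cmulA.
  by move=> e; field: e; rewrite mm.
- exists (m ** star m) => //; rewrite /push cmulA -cmulA (peakM subD pb)//.
  by rewrite mulfK.
Qed.

Lemma normalize_eig (sigma : A -> R[i]) (G : nat -> A) (c : R) (N : nat) :
  0 < c -> (forall i, D (G i)) -> (forall i, (N <= i)%N -> c <= cnorm (G i)) ->
  (forall a, D a -> aeq (fun i => a ** G i) (fun i => sigma a *: G i)) ->
  exists2 g, peaks D sigma g & forall i, G i = (cnorm (G i))%:C%C *: g i.
Proof.
move=> c0 GD Gc GE.
(* The first terms of [G] may vanish; [b i] serves there as a norm-one element of [D]. *)
pose g i := if G i == 0 then b i else ((cnorm (G i))^-1)%:C%C *: G i.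
have gE i : G i = (cnorm (G i))%:C%C *: g i.
  rewrite /g; case: eqP => [->|/eqP G0]; first by rewrite cnorm0 scale0r.
  by rewrite scalerA -rmorphM /= divff ?scale1r// cnorm_eq0.
exists g => //; split.
- by move=> i; rewrite /g; case: ifP => // _; apply: DZ.
- move=> i; rewrite /g; case: eqP => [//|/eqP]; rewrite -cnorm_gt0 => G0.
  by rewrite cnormZ cabs_real gtr0_norm ?invr_gt0// mulVf// gt_eqF.
- move=> a Da; apply/nullP => e e0; have /nullP h := GE a Da.
  have [M hM] := h _ (mulr_gt0 e0 c0).
  exists (maxn M N) => i; rewrite geq_max => /andP[Mi Ni].
  have := hM i Mi; have Gi := Gc i Ni; have G0 := lt_le_trans c0 Gi.
  rewrite [in X in X -> _](gE i) cscaleAr scalerA [sigma a * _]mulrC -scalerA -scalerBr cnormZ.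
  rewrite cabs_real ger0_norm ?cnorm_ge0// => lt.
  rewrite -(ltr_pM2l G0) (lt_le_trans lt)// mulrC ler_pM2r//.
Qed.

(** The vectors m b_i are eigenvectors but may leave [D]; the factor [star m] brings them back. They
    stay away from zero, because compressing by [m] gives (star m ** m)^2 b_i, close to rho (star m
    ** m)^2 b_i. *)
Lemma push_peaks : exists2 g, peaks D (push m) g &
  forall i, m ** b i ** star m = (cnorm (m ** b i ** star m))%:C%C *: g i.
Proof.
pose c := cabs (rho (star m ** m)) ^+ 2.
have c0 : 0 < c by rewrite exprn_gt0// cabs_gt0.
have m0 : m != 0.
  apply: contra_neq mm => ->.
  by rewrite cmul0r -(scale0r (0 : A)) (peakZ subD pb _ (csub0 subD)) mul0r.
have nm : 0 < cnorm m ^+ 2 by rewrite exprn_gt0// cnorm_gt0.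
have h1 := bE (DM Dmm Dmm).
have /nullP/(_ (c / 2))[|N hN] := h1; first by rewrite divr_gt0.
have GD i : D (m ** b i ** star m) by apply: Nm.2.
apply: (@normalize_eig _ _ (c / 2 / cnorm m ^+ 2) N) => // [|i Ni|a Da].
- by rewrite !divr_gt0.
- rewrite ler_pdivrMr//.
  have e1 : star m ** (m ** b i ** star m) ** m = star m ** m ** (star m ** m) ** b i.
    by rewrite -[RHS]cmulA -(commD (bD i) Dmm) !cmulA.
  have := hN i Ni; rewrite -e1 (peakM subD pb)// => h2.
  have := cnormB (star m ** (m ** b i ** star m) ** m)
    (star m ** (m ** b i ** star m) ** m - (rho (star m ** m) * rho (star m ** m)) *: b i).
  rewrite opprB subrKC cnormZ b1 mulr1 cabsM -expr2 -/c.
  have := cnorm_mul (star m ** (m ** b i ** star m)) m.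
  have := cnorm_mul (star m) (m ** b i ** star m); rewrite cnorm_star.
  have := cnorm_ge0 m; nra.
- have h := aeqMr (bounded_cst (star m)) (push_eig Da).
  apply: aeq_trans (aeq_trans (aeq_eq _) h) (aeq_eq _) => i; first by rewrite !cmulA.
  by rewrite cscaleAl.
Qed.

End Push.

Lemma push_in d : D d -> rho d != 0 ->
  (rho (star d ** d) != 0) /\ (forall a, D a -> push d a = rho a).
Proof.
move=> Dd d0; have Dsd := DJ Dd.
have dd : rho (star d ** d) != 0.
  by rewrite (peakM subD pb)// (peakJ subD commD pb)// mulf_neq0// conjC_eq0.
split=> // a Da; rewrite /push -cmulA (commD Da Dd) cmulA.
by rewrite (peakM subD pb (DM Dsd Dd) Da) mulrAC divff// mul1r.
Qed.

(** If the excising sequences built from m b m^* and p b p^* failed to link, undoing the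
    normalisations and compressing by star p and m would give S x S -> 0, where x = star p ** w ** m
    and S = star b ** b. Applying [P] then forces phi(x) = 0. *)
Lemma linked_push w m p : normaliser D m -> normaliser D p ->
  rho (star m ** m) != 0 -> rho (star p ** p) != 0 ->
  phi (star p ** w ** m) != 0 -> linked D w (push m) (push p).
Proof.
move=> Nm Np mm pp pwm.
have [g pg gE] := push_peaks Nm mm; have [h ph hE] := push_peaks Np pp.
exists (fun i => star (g i) ** g i), (fun i => star (h i) ** h i); split.
- exact: peak_excises.
- exact: peak_excises.
have Dmm := normaliser_starM subD auD Nm; have Dpp := normaliser_starM subD auD Np.
move: pwm => /[swap] lwk; apply/negP; rewrite negbK; apply/eqP.
have bsB := bounded_star bB.
pose G i := m ** b i ** star m; pose H i := p ** b i ** star p.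
pose S i := star (b i) ** b i.
have sqE (r : R) y z : y = r%:C%C *: z ->
    star y ** y = ((r ^+ 2)%:C)%C *: (star z ** z).
  move=> ->; rewrite starZ cscaleAl cscaleAr scalerA conj_Creal ?complex_real//.
  by rewrite -rmorphM expr2.
have n1 : null (fun i => star (H i) ** H i ** w ** (star (G i) ** G i)).
  have [C1 hC1] : bounded_seq G.
    by apply: bounded_seqM (bounded_seqM (bounded_cst _) bB) (bounded_cst _).
  have [C2 hC2] : bounded_seq H.
    by apply: bounded_seqM (bounded_seqM (bounded_cst _) bB) (bounded_cst _).
  apply: (@null_le _ _ (C2 ^+ 2 * C1 ^+ 2) _ _ _ lwk) => i.
  rewrite (sqE _ _ _ (gE i)) (sqE _ _ _ (hE i)) !cscaleAl cscaleAr scalerA cnormZ.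
  rewrite -rmorphM cabs_real ger0_norm ?(mulr_ge0 (sqr_ge0 _) (sqr_ge0 _))//.
  have sqr_le (r C : R) : 0 <= r -> r <= C -> r ^+ 2 <= C ^+ 2.
    by move=> r0 rC; rewrite lerXn2r// nnegrE (le_trans r0).
  rewrite ler_wpM2r ?cnorm_ge0//; apply: ler_pM; rewrite ?sqr_ge0//.
    by apply: sqr_le; [exact: cnorm_ge0|exact: hC2].
  by apply: sqr_le; [exact: cnorm_ge0|exact: hC1].
pose V q i := star (b i) ** q ** (q ** b i).
have sq q : D q -> aeq (V q) (fun i => rho q ^+ 2 *: S i).
  move=> Dq; have h1 := aeqMl (bounded_seqM bsB (bounded_cst q)) (bE Dq).
  have h2 := aeqZ (rho q) (aeqMl bsB (bE Dq)).
  apply: aeq_trans (aeq_trans h1 (aeq_eq _)) (aeq_trans h2 (aeq_eq _)).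
    by move=> i; rewrite cscaleAr -cmulA.
  by move=> i; rewrite cscaleAr scalerA -expr2.
pose x := star p ** w ** m.
have n2 : null (fun i => V (star p ** p) i ** x ** V (star m ** m) i).
  have /(nullMl (bounded_cst (star p))) /(nullMr (bounded_cst m)) := n1.
  apply: null_ext => i; rewrite /V /G /H /x !starM !starK.
  rewrite -(commD Dpp (DJ (bD i))) (commD Dmm (bD i)).
  by rewrite !cmulA.
have SB : bounded_seq S by apply: bounded_seqM.
(* By [sq], each factor [V] is asymptotically a nonzero multiple of [S], and the multiples are
   divided out. *)
have n3 : null (fun i => S i ** x ** S i).
  have VB q : bounded_seq (V q).
    exact: bounded_seqM (bounded_seqM bsB (bounded_cst _)) (bounded_seqM (bounded_cst _) bB).
  have c0 : rho (star p ** p) ^+ 2 * rho (star m ** m) ^+ 2 != 0.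
    by rewrite mulf_neq0// expf_neq0.
  apply: null_scaleI c0 _.
  have h1 := aeqMr (bounded_seqM (bounded_cst x) (VB (star m ** m))) (sq _ Dpp).
  have h2 := aeqZ (rho (star p ** p) ^+ 2) (aeqMl (bounded_seqM SB (bounded_cst x)) (sq _ Dmm)).
  apply: aeq_null n2; apply: aeq_sym.
  apply: aeq_trans (aeq_trans (aeq_eq _) h1) (aeq_trans (aeq_eq _) (aeq_trans h2 (aeq_eq _))) => i.
  - by rewrite !cmulA.
  - by rewrite cscaleAl !cmulA.
  - by rewrite cscaleAr scalerA !cmulA.
have DS i : D (S i) by apply: DM => //; apply: DJ.
(* [P] is contractive and a [D]-bimodule map, so x may be replaced by [P x], which acts on [b i] as
   the scalar phi(x). *)
have n4 : null (fun i => S i ** (P x ** S i)).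
  apply: (@null_le _ _ 1 _ _ _ n3) => i; rewrite mul1r.
  rewrite -(cexp_modr cexpP)// -(cexp_modl cexpP)// cmulA.
  exact: (cexp_cnorm cexpP).
have S1 i : cnorm (S i ** S i) = 1.
  have {1}-> : S i = star (S i) by rewrite /S starM starK.
  by rewrite cnorm_starM /S cnorm_starM b1 !expr1n.
apply: null_const_norm1 S1 _; rewrite -/x.
apply: aeq_null n4; apply: aeq_sym.
have h1 := aeqMl (bounded_seqM SB bsB) (bE (PD x)).
apply: aeq_trans (aeq_trans (aeq_eq _) h1) (aeq_eq _) => i.
  rewrite -[RHS]cmulA; congr (_ ** _).
  by rewrite /S cmulA (commD (PD x) (DJ (bD i))) -cmulA.
by rewrite cscaleAr -cmulA.
Qed.

End LocalState.

(** * From the NEP to normalisers *)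

Section Main.
Variables (R : realType) (A : cstarAlgType R) (D : set A).
Hypotheses (sepA : separable A) (cartanD : cartan_subalgebra D).

Let subD := cartan_subalg cartanD.
Let auD := cartan_approx_unit cartanD.
Let commD := (cartan_max_abelian cartanD).1.

(** On a sequence excising x, right multiplication by d is asymptotically the scalar [x d]. *)
Lemma linked_mulr (d w : A) (x y : A -> R[i]) : D d -> linked D (w ** d) x y -> linked D w x y.
Proof.
move=> Dd [k [l [ek el nz]]]; exists k, l; split=> // lwk; apply: nz.
have lB := excises_bounded el.
have h := aeqMl (bounded_seqM lB (bounded_cst w)) (excises_eig subD commD ek Dd).
have : null (fun n => l n ** w ** (x d *: k n)).
  by move/(nullZ (x d)) : lwk; apply: null_ext => n; rewrite cscaleAr.
by move/(aeq_null h); apply: null_ext => n; rewrite !cmulA.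
Qed.

Lemma NEP_normaliser (v d : A) : NEP D (star v) -> D d -> D (star v ** d ** v).
Proof.
move=> nep Dd; apply: (masa_commutant cartanD) => f Df.
apply/eqP; rewrite -subr_eq0; apply: contrapT => /negP c0.
set a := star v ** d ** v in c0.
have [P cexpP faithP] := cartan_cexp cartanD.
have [n Nn Pn0] := faithful_normaliser cartanD cexpP faithP c0.
have [rho [b [pb]]] := peak_exists subD commD sepA (cexp_range cexpP _) Pn0.
have Dnn := normaliser_mul_star subD auD Nn.
have Nsn := normaliser_star Nn.
rewrite -[rho _]/(local_state P rho _) cmulBr (local_stateB cartanD cexpP pb) cmulA.
(* [pn0] now compares two values of f: at [rho], and, once [fE] is applied, at the image of [rho]
   under [star n]. *)
rewrite (local_state_modr cartanD cexpP pb)// subr_eq0 cmulA => pn0.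
have nn0 : rho (n ** star n) != 0.
  have [na0|na0] := eqVneq (local_state P rho (n ** a)) 0; last first.
    exact: (local_state_normaliser_neq0 cartanD cexpP pb Nn na0).
  rewrite na0 mul0r eq_sym -cmulA in pn0.
  exact: (local_state_normaliser_neq0 cartanD cexpP pb Nn pn0).
have nf := local_state_normaliser cartanD cexpP pb a Nn Df.
have fE : local_state P rho (n ** f ** a) =
    push rho (star n) f * local_state P rho (n ** a).
  by rewrite /push starK mulrAC -nf mulrAC mulfV// mul1r.
rewrite fE in pn0.
have na0 : local_state P rho (n ** star v ** d ** v) != 0.
  rewrite -!cmulA [star v ** _]cmulA -/a; apply: contraNneq pn0 => ->.
  by rewrite mulr0 mul0r.
have [m [Nm nvm mv]] := local_state_chain cartanD cexpP pb na0.
have mm0 : rho (star m ** m) != 0.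
  have := local_state_normaliser_neq0 cartanD cexpP pb (normaliser_star Nm) mv.
  by rewrite starK.
have nn0' : rho (star (star n) ** star n) != 0 by rewrite starK.
(* [D] may have no unit to push by, so the point [rho] itself is presented as its own image under n
   ** star n. *)
have [ee0 eE] := push_in cartanD pb Dnn nn0.
have Nnn := normaliser_in subD Dnn.
have l1 : linked D (star v) (push rho m) (push rho (star n)).
  apply: (linked_mulr Dd); apply: (linked_push cartanD cexpP pb) => //.
  by rewrite starK cmulA.
have l2 : linked D (star v) (push rho m) (push rho (n ** star n)).
  apply: (linked_push cartanD cexpP pb) => //.
  have Dsnn := csubJ subD Dnn.
  rewrite -cmulA (local_state_modl cartanD cexpP pb)//.
  rewrite mulf_neq0 ?(peakJ subD commD pb) ?conjC_eq0//.
  by rewrite -[m]starK -starM (local_stateJ cartanD cexpP pb) conjC_eq0.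
(* The image under [m] is linked both to the image under [star n] and to [rho]; the NEP identifies
   these, contradicting their different values at f. *)
have := nep _ _ _ (push_spectrum cartanD pb Nm mm0) (push_spectrum cartanD pb Nsn nn0')
  (push_spectrum cartanD pb Nnn ee0) l1 l2 f Df.
by rewrite eE// => pE; rewrite pE mulrC eqxx in pn0.
Qed.

End Main.

Theorem theorem3p2 (R : realType) (A : cstarAlgType R) (D : set A)
    (sepA : separable A) (cartanD : cartan_subalgebra D) (v : A) :
  normaliser D v <-> NEP D v /\ NEP D (star v).
Proof.
have subD := cartan_subalg cartanD; have commD := (cartan_max_abelian cartanD).1.
have auD := cartan_approx_unit cartanD.
split=> [Nv|[nep neps]].
  split; apply: (normaliser_NEP subD commD auD) => //; exact: normaliser_star.
split=> d Dd; first exact: (NEP_normaliser sepA cartanD).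
rewrite -{1}[v]starK; apply: (NEP_normaliser sepA cartanD) => //.
by rewrite starK.
Qed.
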